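(* Let $\mathscr{A}$ be a category. The following conditions on $\mathscr{A}$ are equivalent: (a) $\mathscr{A}$ is Barr exact and Bourn protomodular, $\mathscr{A}$ has finite coproducts, and the unique morphism $0\to 1$ in $\mathscr{A}$ from the initial object to the terminal object is a regular epimorphism; (b) $\mathscr{A}$ is Barr exact and has finite coproducts, and there exists a monadic functor $\mathscr{A}\to\mathscr{X}$ with $\mathscr{X}$ a semi-abelian category; (c) there exists a monadic functor $\mathscr{A}\to\mathscr{X}$ with $\mathscr{X}$ a semi-abelian category such that the underlying functor $T:\mathscr{X}\to\mathscr{X}$ of the corresponding monad preserves regular epimorphisms and kernel pairs.
   Context: A category is Barr exact if it has finite limits, it is regular (every kernel pair has a coequalizer and regular epimorphisms are pullback stable), and every equivalence relation in it is effective, i.e. is a kernel pair. A category with pullbacks is Bourn protomodular if for every morphism $v:B'\to B$ the pullback functor $v^*:\mathrm{Pt}(B)\to\mathrm{Pt}(B')$ reflects isomorphisms, where $\mathrm{Pt}(B)$ is the category of points over $B$: its objects are triples $(A,\alpha,\beta)$ with $\alpha:A\to B$, $\beta:B\to A$, $\alpha\beta=1_B$, and its morphisms are the morphisms of the objects $A$ compatible with the $\alpha$'s and $\beta$'s. A category is pointed if it has a zero object. A category is semi-abelian if it is pointed, Barr exact, Bourn protomodular, and has finite coproducts. A functor $U:\mathscr{A}\to\mathscr{X}$ is monadic if it has a left adjoint and the comparison functor from $\mathscr{A}$ to the category of algebras of the induced monad on $\mathscr{X}$ is an equivalence of categories. *)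

(* Defs.v *)
From Stdlib Require Import List FinFun ProofIrrelevance IndefiniteDescription.

Set Implicit Arguments.
Unset Strict Implicit.
Unset Printing Implicit Defensive.

(* Hom-sets are types with Leibniz equality.  All categories live in one fixed,
   arbitrary pair of universe levels (objects, morphisms); forming Pt(B) and
   Eilenberg-Moore categories makes the level of morphisms at most that of
   objects. *)
Record Category : Type := {
  Obj :> Type;
  Hom : Obj -> Obj -> Type;
  idm : forall a, Hom a a;
  comp : forall a b c, Hom b c -> Hom a b -> Hom a c;
  comp_id_l : forall a b (f : Hom a b), comp (idm b) f = f;
  comp_id_r : forall a b (f : Hom a b), comp f (idm a) = f;
  comp_assoc : forall a b c d (h : Hom c d) (g : Hom b c) (f : Hom a b),
    comp h (comp g f) = comp (comp h g) f
}.

Arguments Hom {_} _ _.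
Arguments idm {_} _.
Arguments comp {_ _ _ _} _ _.

Declare Scope cat_scope.
Delimit Scope cat_scope with cat.
Open Scope cat_scope.
Notation "g ∘ f" := (comp g f) (at level 40, left associativity) : cat_scope.

Record Functor (C D : Category) : Type := {
  fobj :> C -> D;
  fmap : forall a b : C, Hom a b -> Hom (fobj a) (fobj b);
  fmap_id : forall a : C, fmap (idm a) = idm (fobj a);
  fmap_comp : forall (a b c : C) (g : Hom b c) (f : Hom a b),
    fmap (g ∘ f) = fmap g ∘ fmap f
}.

Arguments fmap {C D} _ {a b} _.

Definition id_functor (C : Category) : Functor C C :=
  {| fobj := fun a => a;
     fmap := fun a b f => f;
     fmap_id := fun a => eq_refl;
     fmap_comp := fun a b c g f => eq_refl |}.

Definition comp_functor (C D E : Category) (G : Functor D E) (F : Functor C D) :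
  Functor C E.
Proof.
  refine {| fobj := fun a => G (F a);
            fmap := fun a b f => fmap G (fmap F f) |}.
  - intros a; now rewrite !fmap_id.
  - intros a b c g f; now rewrite !fmap_comp.
Defined.

Record NatTrans (C D : Category) (F G : Functor C D) : Type := {
  component :> forall a : C, Hom (F a) (G a);
  naturality : forall (a b : C) (f : Hom a b),
    component b ∘ fmap F f = fmap G f ∘ component a
}.

Section Notions.

Variable C : Category.

Definition is_iso (a b : C) (f : Hom a b) : Prop :=
  exists g : Hom b a, g ∘ f = idm a /\ f ∘ g = idm b.

Definition is_initial (z : C) : Prop :=
  forall x : C, exists! f : Hom z x, True.

Definition is_terminal (t : C) : Prop :=
  forall x : C, exists! f : Hom x t, True.

Definition pointed : Prop :=
  exists z : C, is_initial z /\ is_terminal z.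

Definition is_coproduct (I : Type) (x : I -> C) (s : C)
    (inj : forall i, Hom (x i) s) : Prop :=
  forall (y : C) (f : forall i, Hom (x i) y),
    exists! u : Hom s y, forall i, u ∘ inj i = f i.

Definition has_finite_coproducts : Prop :=
  forall I : Type, Finite I -> forall x : I -> C,
    exists (s : C) (inj : forall i, Hom (x i) s), is_coproduct inj.

Definition is_coequalizer (k a b : C) (g h : Hom k a) (f : Hom a b) : Prop :=
  f ∘ g = f ∘ h /\
  forall (y : C) (e : Hom a y), e ∘ g = e ∘ h ->
    exists! u : Hom b y, u ∘ f = e.

Definition regular_epi (a b : C) (f : Hom a b) : Prop :=
  exists (k : C) (g h : Hom k a), is_coequalizer g h f.

Definition is_pullback (a b c p : C) (f : Hom a c) (g : Hom b c)
    (p1 : Hom p a) (p2 : Hom p b) : Prop :=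
  f ∘ p1 = g ∘ p2 /\
  forall (x : C) (h : Hom x a) (k : Hom x b), f ∘ h = g ∘ k ->
    exists! u : Hom x p, p1 ∘ u = h /\ p2 ∘ u = k.

Definition is_kernel_pair (a b k : C) (f : Hom a b) (p1 p2 : Hom k a) : Prop :=
  is_pullback f f p1 p2.

Record Pullback (a b c : C) (f : Hom a c) (g : Hom b c) : Type := {
  pb_obj : C;
  pb_fst : Hom pb_obj a;
  pb_snd : Hom pb_obj b;
  pb_is_pullback : is_pullback f g pb_fst pb_snd
}.

Definition has_pullbacks : Prop :=
  forall (a b c : C) (f : Hom a c) (g : Hom b c), inhabited (Pullback f g).

Definition is_relation (r a : C) (r1 r2 : Hom r a) : Prop :=
  forall (x : C) (u v : Hom x r), r1 ∘ u = r1 ∘ v -> r2 ∘ u = r2 ∘ v -> u = v.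

Definition is_equivalence_relation (r a : C) (r1 r2 : Hom r a) : Prop :=
  is_relation r1 r2 /\
  (exists d : Hom a r, r1 ∘ d = idm a /\ r2 ∘ d = idm a) /\
  (exists s : Hom r r, r1 ∘ s = r2 /\ r2 ∘ s = r1) /\
  (forall (p : C) (p1 p2 : Hom p r), is_pullback r2 r1 p1 p2 ->
     exists t : Hom p r, r1 ∘ t = r1 ∘ p1 /\ r2 ∘ t = r2 ∘ p2).

Definition is_effective (r a : C) (r1 r2 : Hom r a) : Prop :=
  exists (b : C) (f : Hom a b), is_kernel_pair f r1 r2.

End Notions.

Definition finite_category (J : Category) : Prop :=
  Finite J /\ forall i j : J, Finite (Hom i j).

Record Cone (J C : Category) (D : Functor J C) : Type := {
  apex : C;
  leg : forall j : J, Hom apex (D j);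
  leg_natural : forall (i j : J) (u : Hom i j), fmap D u ∘ leg i = leg j
}.

Definition is_limit (J C : Category) (D : Functor J C) (K : Cone D) : Prop :=
  forall K' : Cone D, exists! m : Hom (apex K') (apex K),
    forall j : J, leg K j ∘ m = leg K' j.

Definition has_finite_limits (C : Category) : Prop :=
  forall J : Category, finite_category J ->
    forall D : Functor J C, exists K : Cone D, is_limit K.

Definition is_regular (C : Category) : Prop :=
  (forall (a b k : C) (f : Hom a b) (p1 p2 : Hom k a), is_kernel_pair f p1 p2 ->
     exists (q : C) (e : Hom a q), is_coequalizer p1 p2 e) /\
  (forall (a b c p : C) (f : Hom a c) (g : Hom b c) (p1 : Hom p a) (p2 : Hom p b),
     is_pullback f g p1 p2 -> regular_epi f -> regular_epi p2).

Definition barr_exact (C : Category) : Prop :=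
  has_finite_limits C /\
  is_regular C /\
  (forall (r a : C) (r1 r2 : Hom r a),
     is_equivalence_relation r1 r2 -> is_effective r1 r2).

Section Points.

Variables (C : Category) (b : C).

Record Point : Type := {
  pt_obj : C;
  pt_proj : Hom pt_obj b;
  pt_sec : Hom b pt_obj;
  pt_split : pt_proj ∘ pt_sec = idm b
}.

Record PointHom (x y : Point) : Type := {
  pt_map : Hom (pt_obj x) (pt_obj y);
  pt_map_proj : pt_proj y ∘ pt_map = pt_proj x;
  pt_map_sec : pt_map ∘ pt_sec x = pt_sec y
}.

Lemma PointHom_eq (x y : Point) (f g : PointHom x y) :
  pt_map f = pt_map g -> f = g.
Proof.
  destruct f as [f f1 f2], g as [g g1 g2]; simpl; intros <-.
  f_equal; apply proof_irrelevance.
Qed.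

Definition Point_id (x : Point) : PointHom x x :=
  {| pt_map := idm (pt_obj x);
     pt_map_proj := comp_id_r (pt_proj x);
     pt_map_sec := comp_id_l (pt_sec x) |}.

Definition Point_comp (x y z : Point) (g : PointHom y z) (f : PointHom x y) :
  PointHom x z.
Proof.
  refine {| pt_map := pt_map g ∘ pt_map f |}.
  - now rewrite comp_assoc, !pt_map_proj.
  - now rewrite <- comp_assoc, !pt_map_sec.
Defined.

Definition Pt : Category.
Proof.
  refine {| Obj := Point; Hom := PointHom;
            idm := Point_id; comp := Point_comp |}.
  - intros x y f; apply PointHom_eq, comp_id_l.
  - intros x y f; apply PointHom_eq, comp_id_r.
  - intros x y z w h g f; apply PointHom_eq, comp_assoc.
Defined.

End Points.

(* The functor v^* is only determined up to isomorphism by the existence of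
   pullbacks; here a pullback of each cospan is selected by choice. *)
Definition chosen_pullback (C : Category) (P : has_pullbacks C)
    (a b c : C) (f : Hom a c) (g : Hom b c) : Pullback f g :=
  proj1_sig (constructive_indefinite_description (fun _ => True)
    (match P a b c f g with inhabits K => ex_intro _ K I end)).

Section Lift.

Variables (C : Category) (a b c : C) (f : Hom a c) (g : Hom b c).
Variable K : Pullback f g.

Lemma pb_lift_ex (x : C) (h : Hom x a) (k : Hom x b) (e : f ∘ h = g ∘ k) :
  exists u : Hom x (pb_obj K), pb_fst K ∘ u = h /\ pb_snd K ∘ u = k.
Proof.
  destruct (proj2 (pb_is_pullback K) x h k e) as [u [Hu _]]; now exists u.
Qed.

Definition pb_lift (x : C) (h : Hom x a) (k : Hom x b) (e : f ∘ h = g ∘ k) :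
  Hom x (pb_obj K) :=
  proj1_sig (constructive_indefinite_description _ (pb_lift_ex e)).

Lemma pb_fst_lift (x : C) (h : Hom x a) (k : Hom x b) (e : f ∘ h = g ∘ k) :
  pb_fst K ∘ pb_lift e = h.
Proof.
  exact (proj1 (proj2_sig (constructive_indefinite_description _ (pb_lift_ex e)))).
Qed.

Lemma pb_snd_lift (x : C) (h : Hom x a) (k : Hom x b) (e : f ∘ h = g ∘ k) :
  pb_snd K ∘ pb_lift e = k.
Proof.
  exact (proj2 (proj2_sig (constructive_indefinite_description _ (pb_lift_ex e)))).
Qed.

Lemma pb_hom_ext (x : C) (u v : Hom x (pb_obj K)) :
  pb_fst K ∘ u = pb_fst K ∘ v -> pb_snd K ∘ u = pb_snd K ∘ v -> u = v.
Proof.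
  intros e1 e2; destruct (pb_is_pullback K) as [sq univ].
  assert (e : f ∘ (pb_fst K ∘ v) = g ∘ (pb_snd K ∘ v))
    by now rewrite !comp_assoc, sq.
  destruct (univ x _ _ e) as [w [_ uniq]].
  rewrite <- (uniq u (conj e1 e2)); now apply uniq.
Qed.

End Lift.

Section ChangeOfBase.

Variables (C : Category) (P : has_pullbacks C) (b' b : C) (v : Hom b' b).

Definition pbv (x : Pt b) : Pullback v (pt_proj x) :=
  chosen_pullback P v (pt_proj x).

Lemma cob_sec_square (x : Pt b) : v ∘ idm b' = pt_proj x ∘ (pt_sec x ∘ v).
Proof. now rewrite comp_assoc, pt_split, comp_id_l, comp_id_r. Qed.

Definition cob_obj (x : Pt b) : Pt b' :=
  {| pt_obj := pb_obj (pbv x);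
     pt_proj := pb_fst (pbv x);
     pt_sec := pb_lift (pbv x) (cob_sec_square x);
     pt_split := pb_fst_lift (pbv x) (cob_sec_square x) |}.

Lemma cob_map_square (x y : Pt b) (f : Hom x y) :
  v ∘ pb_fst (pbv x) = pt_proj y ∘ (pt_map f ∘ pb_snd (pbv x)).
Proof.
  rewrite comp_assoc, pt_map_proj; exact (proj1 (pb_is_pullback (pbv x))).
Qed.

Definition cob_map (x y : Pt b) (f : Hom x y) : Hom (cob_obj x) (cob_obj y).
Proof.
  refine (@Build_PointHom C b' (cob_obj x) (cob_obj y)
            (pb_lift (pbv y) (cob_map_square f)) _ _); simpl.
  - apply pb_fst_lift.
  - apply pb_hom_ext.
    + now rewrite comp_assoc, !pb_fst_lift.
    + rewrite comp_assoc, !pb_snd_lift, <- comp_assoc, pb_snd_lift.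
      now rewrite comp_assoc, pt_map_sec.
Defined.

Definition change_of_base : Functor (Pt b) (Pt b').
Proof.
  refine {| fobj := cob_obj; fmap := cob_map |}.
  - intros x; apply PointHom_eq, pb_hom_ext; simpl.
    + now rewrite pb_fst_lift, comp_id_r.
    + now rewrite pb_snd_lift, comp_id_l, comp_id_r.
  - intros x y z g f; apply PointHom_eq, pb_hom_ext; simpl.
    + now rewrite comp_assoc, !pb_fst_lift.
    + rewrite comp_assoc, !pb_snd_lift, <- !comp_assoc.
      now rewrite pb_snd_lift.
Defined.

End ChangeOfBase.

Definition reflects_isos (C D : Category) (F : Functor C D) : Prop :=
  forall (a b : C) (f : Hom a b), is_iso (fmap F f) -> is_iso f.

Definition protomodular (C : Category) : Prop :=
  exists P : has_pullbacks C,
    forall (b' b : C) (v : Hom b' b), reflects_isos (change_of_base P v).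

Definition semi_abelian (C : Category) : Prop :=
  pointed C /\ barr_exact C /\ protomodular C /\ has_finite_coproducts C.

Record Monad (C : Category) : Type := {
  monad_functor :> Functor C C;
  monad_unit : NatTrans (id_functor C) monad_functor;
  monad_mult : NatTrans (comp_functor monad_functor monad_functor) monad_functor;
  monad_unit_l : forall x : C,
    monad_mult x ∘ monad_unit (monad_functor x) = idm (monad_functor x);
  monad_unit_r : forall x : C,
    monad_mult x ∘ fmap monad_functor (monad_unit x) = idm (monad_functor x);
  monad_mult_assoc : forall x : C,
    monad_mult x ∘ monad_mult (monad_functor x)
    = monad_mult x ∘ fmap monad_functor (monad_mult x)
}.

Section Algebras.

Variables (C : Category) (T : Monad C).

Record Algebra : Type := {
  alg_obj : C;
  alg_str : Hom (T alg_obj) alg_obj;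
  alg_unit : alg_str ∘ monad_unit T alg_obj = idm alg_obj;
  alg_mult : alg_str ∘ monad_mult T alg_obj = alg_str ∘ fmap T alg_str
}.

Record AlgebraHom (x y : Algebra) : Type := {
  alg_map : Hom (alg_obj x) (alg_obj y);
  alg_map_str : alg_map ∘ alg_str x = alg_str y ∘ fmap T alg_map
}.

Lemma AlgebraHom_eq (x y : Algebra) (f g : AlgebraHom x y) :
  alg_map f = alg_map g -> f = g.
Proof.
  destruct f as [f f1], g as [g g1]; simpl; intros <-.
  f_equal; apply proof_irrelevance.
Qed.

Definition Algebra_id (x : Algebra) : AlgebraHom x x.
Proof.
  refine {| alg_map := idm (alg_obj x) |}.
  now rewrite fmap_id, comp_id_l, comp_id_r.
Defined.

Definition Algebra_comp (x y z : Algebra) (g : AlgebraHom y z)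
    (f : AlgebraHom x y) : AlgebraHom x z.
Proof.
  refine {| alg_map := alg_map g ∘ alg_map f |}.
  rewrite fmap_comp, <- comp_assoc, alg_map_str.
  now rewrite !comp_assoc, alg_map_str.
Defined.

Definition EilenbergMoore : Category.
Proof.
  refine {| Obj := Algebra; Hom := AlgebraHom;
            idm := Algebra_id; comp := Algebra_comp |}.
  - intros x y f; apply AlgebraHom_eq, comp_id_l.
  - intros x y f; apply AlgebraHom_eq, comp_id_r.
  - intros x y z w h g f; apply AlgebraHom_eq, comp_assoc.
Defined.

End Algebras.

(* F is left adjoint to U. *)
Record Adjunction (X A : Category) (F : Functor X A) (U : Functor A X) : Type := {
  adj_unit : NatTrans (id_functor X) (comp_functor U F);
  adj_counit : NatTrans (comp_functor F U) (id_functor A);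
  adj_triangle_l : forall x : X,
    adj_counit (F x) ∘ fmap F (adj_unit x) = idm (F x);
  adj_triangle_r : forall a : A,
    fmap U (adj_counit a) ∘ adj_unit (U a) = idm (U a)
}.

Section Comparison.

Variables (X A : Category) (F : Functor X A) (U : Functor A X).
Variable adj : Adjunction F U.

Definition induced_mult :
  NatTrans (comp_functor (comp_functor U F) (comp_functor U F))
           (comp_functor U F).
Proof.
  refine (@Build_NatTrans X X
            (comp_functor (comp_functor U F) (comp_functor U F))
            (comp_functor U F)
            (fun x => fmap U (adj_counit adj (F x))) _).
  intros x y f; simpl; rewrite <- !fmap_comp; f_equal.
  exact (naturality (adj_counit adj) (fmap F f)).
Defined.

Definition induced_monad : Monad X.
Proof.
  refine {| monad_functor := comp_functor U F;
            monad_unit := adj_unit adj;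
            monad_mult := induced_mult |}; intros x; simpl.
  - apply adj_triangle_r.
  - rewrite <- fmap_comp, <- fmap_id; f_equal.
    exact (adj_triangle_l adj x).
  - rewrite <- !fmap_comp; f_equal; symmetry.
    exact (naturality (adj_counit adj) (adj_counit adj (F x))).
Defined.

Definition comparison_obj (a : A) : EilenbergMoore induced_monad.
Proof.
  refine (@Build_Algebra X induced_monad (U a) (fmap U (adj_counit adj a)) _ _);
    simpl.
  - apply adj_triangle_r.
  - rewrite <- !fmap_comp; f_equal; symmetry.
    exact (naturality (adj_counit adj) (adj_counit adj a)).
Defined.

Definition comparison_map (a b : A) (f : Hom a b) :
  Hom (comparison_obj a) (comparison_obj b).
Proof.
  refine (@Build_AlgebraHom X induced_monad (comparison_obj a) (comparison_obj b)
            (fmap U f) _); simpl.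
  rewrite <- !fmap_comp; f_equal; symmetry.
  exact (naturality (adj_counit adj) f).
Defined.

Definition comparison : Functor A (EilenbergMoore induced_monad).
Proof.
  refine {| fobj := comparison_obj; fmap := comparison_map |}.
  - intros a; apply AlgebraHom_eq, fmap_id.
  - intros a b c g f; apply AlgebraHom_eq, fmap_comp.
Defined.

End Comparison.

Definition naturally_isomorphic (C D : Category) (F G : Functor C D) : Prop :=
  exists t : NatTrans F G, forall a : C, is_iso (t a).

Definition is_equivalence (C D : Category) (F : Functor C D) : Prop :=
  exists G : Functor D C,
    naturally_isomorphic (comp_functor G F) (id_functor C) /\
    naturally_isomorphic (comp_functor F G) (id_functor D).

(* Monadicity with a specified adjunction; the property does not depend on which
   left adjoint is taken, since left adjoints are unique up to isomorphism. *)
Definition monadic_adjunction (X A : Category) (F : Functor X A)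
    (U : Functor A X) (adj : Adjunction F U) : Prop :=
  is_equivalence (comparison adj).

Definition monadic (A X : Category) (U : Functor A X) : Prop :=
  exists (F : Functor X A) (adj : Adjunction F U), monadic_adjunction adj.

Definition preserves_regular_epis (C D : Category) (F : Functor C D) : Prop :=
  forall (a b : C) (f : Hom a b), regular_epi f -> regular_epi (fmap F f).

Definition preserves_kernel_pairs (C D : Category) (F : Functor C D) : Prop :=
  forall (a b k : C) (f : Hom a b) (p1 p2 : Hom k a),
    is_kernel_pair f p1 p2 -> is_kernel_pair (fmap F f) (fmap F p1) (fmap F p2).

(* Main.v *)
Require Import Defs.
From Stdlib Require Import List IndefiniteDescription ProofIrrelevance.

Set Implicit Arguments.
Unset Strict Implicit.
Unset Printing Implicit Defensive.

(** The three conditions are proved equivalent along (a) => (c) => (b) => (a).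

    (a) => (c).  Let [v : z -> t] be the morphism from the initial to the terminal
    object.  The slice [A/z] is pointed, because [z] is initial, and it inherits
    exactness, protomodularity and coproducts from [A], so it is semi-abelian
    ([slice_semi_abelian]).  Pulling back along [v], that is taking products with
    [z], gives a functor [A -> A/z] whose left adjoint forgets the map to [z].
    It reflects isomorphisms because the projections [z × a -> a] are pullbacks of
    the regular epimorphism [v] ([base_change_reflects_isos]), and it preserves
    regular epimorphisms and pullbacks.  The left adjoint preserves both as well,
    hence so does the induced monad.  Monadicity comes from the crude form of
    Beck's theorem ([crude_monadicity]), which asks for coequalizers of reflexive
    pairs in [A] and for their preservation.

    These coequalizers are where protomodularity enters.  In a protomodular
    category every relation is difunctional ([protomodular_difunctional]), so
    reflexive relations are equivalence relations.  In an exact protomodular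
    category the image of a reflexive pair is therefore the kernel pair of some
    regular epimorphism, which is the coequalizer of the pair
    ([reflexive_pair_quotient]); functors preserving regular epimorphisms and
    kernel pairs preserve this construction.

    (c) => (b).  If the monad [T] preserves regular epimorphisms and kernel pairs,
    then the quotient in [X] of a kernel pair of algebras carries an algebra
    structure ([forget_algebra_lifts_quotients]).  Thus [U] preserves pullbacks,
    reflects isomorphisms and lifts quotients of kernel pairs, and this is enough
    to carry exactness from [X] to [A] ([barr_exact_transfer]); the same transfer
    lemma yields the exactness of slices.  Protomodularity is carried over too, so
    [A] has reflexive coequalizers, and these give its finite coproducts
    ([monadic_coproducts]).

    (b) => (a).  Protomodularity is transferred along [U].  The image of the
    morphism from the initial to the terminal object is a subobject of the
    terminal object, and [U] sends it to a subobject of the zero object of [X],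
    which has no proper subobjects; as [U] reflects isomorphisms, the image is
    everything ([monadic_pointed_initial_terminal]). *)

(** * Coequalizers, pullbacks and kernel pairs *)

Lemma whisker (C : Category) (a b c : C) (f : Hom b c) (g : Hom a b) (h : Hom a c) :
  f ∘ g = h -> forall (x : C) (k : Hom x a), f ∘ (g ∘ k) = h ∘ k.
Proof. intros <- x k; apply comp_assoc. Qed.

Tactic Notation "assoc" := rewrite <- ?comp_assoc.

(** Rewriting with an equation between composites modulo associativity: all
    composites are kept associated to the right, and the redex may be followed
    by a further factor. *)
Tactic Notation "crw" uconstr(e) :=
  rewrite <- ?comp_assoc; first [rewrite (whisker e) | rewrite e];
  rewrite <- ?comp_assoc, ?comp_id_l, ?comp_id_r.

Tactic Notation "crw" "<-" uconstr(e) :=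
  rewrite <- ?comp_assoc;
  first [rewrite (whisker (eq_sym e)) | rewrite (eq_sym e)];
  rewrite <- ?comp_assoc, ?comp_id_l, ?comp_id_r.

Section Basics.

Variable C : Category.

Definition mono (a b : C) (f : Hom a b) : Prop :=
  forall (x : C) (u v : Hom x a), f ∘ u = f ∘ v -> u = v.

Definition epi (a b : C) (f : Hom a b) : Prop :=
  forall (x : C) (u v : Hom b x), u ∘ f = v ∘ f -> u = v.

Definition is_product (a b p : C) (p1 : Hom p a) (p2 : Hom p b) : Prop :=
  forall (x : C) (h : Hom x a) (k : Hom x b),
    exists! u : Hom x p, p1 ∘ u = h /\ p2 ∘ u = k.

Lemma iso_id (a : C) : is_iso (idm a).
Proof. exists (idm a); split; apply comp_id_l. Qed.

Lemma iso_comp (a b c : C) (g : Hom b c) (f : Hom a b) :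
  is_iso g -> is_iso f -> is_iso (g ∘ f).
Proof.
  intros [g' [Hg1 Hg2]] [f' [Hf1 Hf2]]; exists (f' ∘ g'); split.
  - crw Hg1; exact Hf1.
  - crw Hf2; exact Hg2.
Qed.

Lemma iso_mono (a b : C) (f : Hom a b) : is_iso f -> mono f.
Proof.
  intros [g [Hg _]] x u v e.
  rewrite <- (comp_id_l u), <- (comp_id_l v), <- Hg; assoc; now rewrite e.
Qed.

Lemma iso_epi (a b : C) (f : Hom a b) : is_iso f -> epi f.
Proof.
  intros [g [_ Hg]] x u v e.
  rewrite <- (comp_id_r u), <- (comp_id_r v), <- Hg, !comp_assoc; now rewrite e.
Qed.

Lemma mono_split_iso (a b : C) (m : Hom a b) (s : Hom b a) :
  mono m -> m ∘ s = idm b -> is_iso m.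
Proof.
  intros Hm Hs; exists s; split; [apply Hm | exact Hs].
  crw Hs; reflexivity.
Qed.

Lemma terminal_ext (t : C) :
  is_terminal t -> forall (x : C) (u v : Hom x t), u = v.
Proof.
  intros Ht x u v; destruct (Ht x) as [w [_ Hw]].
  now rewrite <- (Hw u I), <- (Hw v I).
Qed.

Lemma initial_ext (z : C) :
  is_initial z -> forall (x : C) (u v : Hom z x), u = v.
Proof.
  intros Hz x u v; destruct (Hz x) as [w [_ Hw]].
  now rewrite <- (Hw u I), <- (Hw v I).
Qed.

Lemma coproduct_ext (I : Type) (x : I -> C) (s : C) (inj : forall i, Hom (x i) s) :
  is_coproduct inj ->
  forall (y : C) (u v : Hom s y), (forall i, u ∘ inj i = v ∘ inj i) -> u = v.
Proof.
  intros H y u v e; destruct (H y (fun i => v ∘ inj i)) as [w [_ Hw]].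
  now rewrite <- (Hw u e), <- (Hw v (fun i => eq_refl)).
Qed.

Lemma coequalizer_epi (k a b : C) (g h : Hom k a) (f : Hom a b) :
  is_coequalizer g h f -> epi f.
Proof.
  intros [Hf Hu] x u v e.
  destruct (Hu x (v ∘ f)) as [w [_ Hw]].
  - assoc; now rewrite Hf.
  - now rewrite <- (Hw u e), <- (Hw v eq_refl).
Qed.

Lemma coequalizer_regular_epi (k a b : C) (g h : Hom k a) (f : Hom a b) :
  is_coequalizer g h f -> regular_epi f.
Proof. intros H; now exists k, g, h. Qed.

Lemma regular_epi_epi (a b : C) (f : Hom a b) : regular_epi f -> epi f.
Proof. intros (k & g & h & H); exact (coequalizer_epi H). Qed.

Lemma coequalizer_iso (k a b c : C) (g h : Hom k a) (f : Hom a b) (i : Hom b c) :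
  is_coequalizer g h f -> is_iso i -> is_coequalizer g h (i ∘ f).
Proof.
  intros [Hf Hu] [j [Hj1 Hj2]]; split.
  - assoc; now rewrite Hf.
  - intros y e He; destruct (Hu y e He) as [w [Hw Hw']].
    exists (w ∘ j); split.
    + crw Hj1; exact Hw.
    + intros w' H'; rewrite (Hw' (w' ∘ i)).
      * crw Hj2; reflexivity.
      * rewrite <- H'; assoc; reflexivity.
Qed.

Lemma regular_epi_iso (a b c : C) (f : Hom a b) (i : Hom b c) :
  regular_epi f -> is_iso i -> regular_epi (i ∘ f).
Proof.
  intros (k & g & h & H) Hi; exists k, g, h; now apply coequalizer_iso.
Qed.

Lemma coequalizer_unique (k a b c : C) (g h : Hom k a) (e : Hom a b) (f : Hom a c) :
  is_coequalizer g h e -> is_coequalizer g h f ->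
  exists i : Hom b c, is_iso i /\ i ∘ e = f.
Proof.
  intros He Hf.
  destruct (proj2 He c f (proj1 Hf)) as [i [Hi _]].
  destruct (proj2 Hf b e (proj1 He)) as [j [Hj _]].
  exists i; split; [exists j; split | exact Hi].
  - apply (coequalizer_epi He); crw Hi; now rewrite Hj.
  - apply (coequalizer_epi Hf); crw Hj; now rewrite Hi.
Qed.

Lemma coequalizer_precomp_epi (l k a b : C) (c : Hom l k) (g h : Hom k a)
    (f : Hom a b) :
  epi c -> is_coequalizer g h f -> is_coequalizer (g ∘ c) (h ∘ c) f.
Proof.
  intros Hc [Hf Hu]; split.
  - rewrite !comp_assoc; now rewrite Hf.
  - intros y e He; apply Hu, Hc; assoc; exact He.
Qed.

(** As [m] is a monomorphism, [e] already identifies the pair of which [m ∘ e]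
    is the coequalizer, so [e] factors through [m ∘ e], which splits [m]. *)
Lemma mono_regular_epi_iso (a b c : C) (m : Hom b c) (e : Hom a b) :
  mono m -> regular_epi (m ∘ e) -> is_iso m.
Proof.
  intros Hm (k & g & h & H).
  destruct (proj2 H b e) as [u [Hu _]].
  { apply Hm; rewrite !comp_assoc; exact (proj1 H). }
  apply (mono_split_iso (s := u) Hm), (coequalizer_epi H).
  crw Hu; reflexivity.
Qed.

Lemma pullback_intro (a b c q : C) (f : Hom a c) (g : Hom b c)
    (q1 : Hom q a) (q2 : Hom q b) :
  f ∘ q1 = g ∘ q2 ->
  (forall (x : C) (h : Hom x a) (k : Hom x b), f ∘ h = g ∘ k ->
     exists u : Hom x q, q1 ∘ u = h /\ q2 ∘ u = k) ->
  (forall (x : C) (u v : Hom x q), q1 ∘ u = q1 ∘ v -> q2 ∘ u = q2 ∘ v -> u = v) ->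
  is_pullback f g q1 q2.
Proof.
  intros sq ex un; split; [exact sq | intros x h k e].
  destruct (ex x h k e) as [u [Hu1 Hu2]]; exists u; split; [now split |].
  intros v [Hv1 Hv2]; apply un; congruence.
Qed.

Section PullbackFacts.

Variables (a b c p : C) (f : Hom a c) (g : Hom b c) (p1 : Hom p a) (p2 : Hom p b).
Hypothesis H : is_pullback f g p1 p2.

Lemma pullback_ext (x : C) (u v : Hom x p) :
  p1 ∘ u = p1 ∘ v -> p2 ∘ u = p2 ∘ v -> u = v.
Proof. exact (pb_hom_ext (K := Build_Pullback H) (u := u) (v := v)). Qed.

Lemma pullback_lift (x : C) (h : Hom x a) (k : Hom x b) :
  f ∘ h = g ∘ k -> exists u : Hom x p, p1 ∘ u = h /\ p2 ∘ u = k.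
Proof. exact (pb_lift_ex (Build_Pullback H) (h := h) (k := k)). Qed.

Lemma pullback_of_iso (q : C) (i : Hom q p) :
  is_iso i -> is_pullback f g (p1 ∘ i) (p2 ∘ i).
Proof.
  intros Hi; pose proof (iso_mono Hi) as Hm; destruct Hi as [j [Hj1 Hj2]].
  apply pullback_intro.
  - rewrite !comp_assoc; now rewrite (proj1 H).
  - intros x h k e; destruct (pullback_lift e) as [u [Hu1 Hu2]].
    exists (j ∘ u); split; crw Hj2; assumption.
  - intros x u v e1 e2; apply Hm, pullback_ext; rewrite !comp_assoc; assumption.
Qed.

Lemma pullback_comparison (q : C) (q1 : Hom q a) (q2 : Hom q b) :
  is_pullback f g q1 q2 ->
  exists i : Hom q p, is_iso i /\ p1 ∘ i = q1 /\ p2 ∘ i = q2.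
Proof.
  intros Hq.
  destruct (pullback_lift (proj1 Hq)) as [i [Hi1 Hi2]].
  destruct (proj2 Hq p p1 p2 (proj1 H)) as [j [[Hj1 Hj2] _]].
  exists i; split; [exists j; split | now split].
  - destruct (proj2 Hq q q1 q2 (proj1 Hq)) as [w [_ Hw]].
    rewrite <- (Hw (idm q)), (Hw (j ∘ i)); trivial; split;
      try apply comp_id_r; rewrite comp_assoc; congruence.
  - apply pullback_ext; rewrite comp_assoc, comp_id_r; congruence.
Qed.

Lemma pullback_mono : mono g -> mono p1.
Proof.
  intros Hg x u v e; apply pullback_ext; [exact e | apply Hg].
  rewrite !comp_assoc, <- (proj1 H); assoc; now rewrite e.
Qed.

End PullbackFacts.

Lemma kernel_pair_diagonal (a b k : C) (f : Hom a b) (p1 p2 : Hom k a) :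
  is_kernel_pair f p1 p2 -> exists d : Hom a k, p1 ∘ d = idm a /\ p2 ∘ d = idm a.
Proof. intros H; now apply (pullback_lift H). Qed.

Lemma regular_epi_coequalizer (a b k : C) (f : Hom a b) (p1 p2 : Hom k a) :
  regular_epi f -> is_kernel_pair f p1 p2 -> is_coequalizer p1 p2 f.
Proof.
  intros (l & g & h & [Hf Hu]) Hk; split; [exact (proj1 Hk) |].
  intros y e He; apply Hu.
  destruct (pullback_lift Hk Hf) as [u [<- <-]].
  rewrite !comp_assoc; now rewrite He.
Qed.

Lemma coequalizer_kernel_pair (a b c k : C) (f : Hom a b) (e : Hom a c)
    (p1 p2 : Hom k a) :
  is_kernel_pair f p1 p2 -> is_coequalizer p1 p2 e -> is_kernel_pair e p1 p2.
Proof.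
  intros Hk [He Hu]; apply pullback_intro.
  - exact He.
  - destruct (Hu b f (proj1 Hk)) as [m [Hm _]].
    intros x u v e0; apply (pullback_lift Hk).
    rewrite <- Hm; assoc; now rewrite e0.
  - intros x u v; exact (pullback_ext Hk (u := u) (v := v)).
Qed.

Lemma product_ext (a b p : C) (p1 : Hom p a) (p2 : Hom p b) :
  is_product p1 p2 ->
  forall (x : C) (u v : Hom x p), p1 ∘ u = p1 ∘ v -> p2 ∘ u = p2 ∘ v -> u = v.
Proof.
  intros H x u v e1 e2; destruct (H x (p1 ∘ v) (p2 ∘ v)) as [w [_ Hw]].
  rewrite <- (Hw u (conj e1 e2)); now apply Hw.
Qed.

Lemma product_lift (a b p : C) (p1 : Hom p a) (p2 : Hom p b) :
  is_product p1 p2 ->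
  forall (x : C) (h : Hom x a) (k : Hom x b),
  exists u : Hom x p, p1 ∘ u = h /\ p2 ∘ u = k.
Proof. intros H x h k; destruct (H x h k) as [u [Hu _]]; now exists u. Qed.

End Basics.

(** * Finite limits *)

Lemma limit_ext (J C : Category) (D : Functor J C) (K : Cone D) :
  is_limit K -> forall (x : C) (u v : Hom x (apex K)),
  (forall j, leg K j ∘ u = leg K j ∘ v) -> u = v.
Proof.
  intros HK x u v e.
  set (K' := {| apex := x; leg := fun j => leg K j ∘ v;
                leg_natural := fun i j w =>
                  eq_trans (comp_assoc _ _ _)
                    (f_equal (fun h => h ∘ v) (leg_natural K w)) |}).
  destruct (HK K') as [w [_ Hw]].
  rewrite <- (Hw u e); now apply Hw.
Qed.

Definition map_cone (J C D : Category) (G : Functor C D) (F : Functor J C)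
    (K : Cone F) : Cone (comp_functor G F).
Proof.
  refine (@Build_Cone J D (comp_functor G F) (G (apex K))
            (fun j => fmap G (leg K j)) _).
  intros i j u; simpl; rewrite <- fmap_comp; f_equal; exact (leg_natural K u).
Defined.

Definition empty_category : Category.
Proof.
  refine {| Obj := Empty_set; Hom := fun _ _ => Empty_set;
            idm := fun a => a; comp := fun a _ _ _ _ => a |};
  intros [].
Defined.

Inductive cospan_vertex : Type := cospan_left | cospan_right | cospan_sink.

Definition cospan_arrow (i j : cospan_vertex) : Type :=
  match i, j with
  | cospan_left, cospan_left | cospan_right, cospan_right => unit
  | _, cospan_sink => unit
  | _, _ => Empty_set
  end.

Definition cospan_category : Category.
Proof.
  refine {| Obj := cospan_vertex; Hom := cospan_arrow;
            idm := fun i => match i with cospan_left | cospan_right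
                                        | cospan_sink => tt end;
            comp := _ |}.
  Unshelve. 4: { intros [] [] []; simpl; intros; try exact tt; contradiction. }
  all: intros [] []; simpl; try (intros []; reflexivity).
  all: intros [] []; simpl; intros; try contradiction; reflexivity.
Defined.

Definition cospan_functor (C : Category) (a b c : C) (f : Hom a c) (g : Hom b c) :
  Functor cospan_category C.
Proof.
  refine (@Build_Functor cospan_category C
            (fun i => match i with cospan_left => a | cospan_right => b
                                 | cospan_sink => c end)
            (fun i j => match i, j return cospan_arrow i j -> Hom
                 (match i with cospan_left => a | cospan_right => b
                             | cospan_sink => c end)
                 (match j with cospan_left => a | cospan_right => b
                             | cospan_sink => c end) with
               | cospan_left, cospan_left => fun _ => idm a
               | cospan_right, cospan_right => fun _ => idm b
               | cospan_sink, cospan_sink => fun _ => idm c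
               | cospan_left, cospan_sink => fun _ => f
               | cospan_right, cospan_sink => fun _ => g
               | _, _ => fun e => match e with end
               end) _ _).
  - intros []; reflexivity.
  - intros [] [] []; simpl; intros [] []; now rewrite ?comp_id_l, ?comp_id_r.
Defined.

Definition cospan_cone (C : Category) (a b c x : C) (f : Hom a c) (g : Hom b c)
    (h : Hom x a) (k : Hom x b) (e : f ∘ h = g ∘ k) : Cone (cospan_functor f g).
Proof.
  refine (@Build_Cone cospan_category C (cospan_functor f g) x
            (fun j => match j with cospan_left => h | cospan_right => k
                                 | cospan_sink => f ∘ h end) _).
  intros [] []; simpl; intros []; rewrite ?comp_id_l; congruence.
Defined.

Definition empty_functor (C : Category) : Functor empty_category C.
Proof.
  refine (@Build_Functor empty_category C (fun e => match e with end)
            (fun e => match e with end) _ _); intros [].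
Defined.

Section FiniteLimits.

Variable C : Category.
Hypothesis lim : has_finite_limits C.

Lemma finite_limits_terminal : exists t : C, is_terminal t.
Proof.
  destruct (lim (J := empty_category)) with (D := empty_functor C) as [K HK].
  { split; [exists nil; intros [] | intros []]. }
  exists (apex K); intros x.
  destruct (HK {| apex := x; leg := fun j : empty_category => match j with end;
                  leg_natural := fun j : empty_category => match j with end |})
    as [u [_ Hu]].
  exists u; split; [exact I |]; intros v _; apply Hu; intros [].
Qed.

Lemma finite_limits_pullbacks : has_pullbacks C.
Proof.
  intros a b c f g.
  destruct (lim (J := cospan_category)) with (D := cospan_functor f g) as [K HK].
  { split.
    - exists (cospan_left :: cospan_right :: cospan_sink :: nil); intros []; simpl; auto.
    - intros [] []; simpl;
        solve [exists (tt :: nil); intros []; simpl; auto | exists nil; intros []]. }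
  assert (Hl : f ∘ leg K cospan_left = leg K cospan_sink)
    by exact (leg_natural K (i := cospan_left) (j := cospan_sink) tt).
  assert (Hr : g ∘ leg K cospan_right = leg K cospan_sink)
    by exact (leg_natural K (i := cospan_right) (j := cospan_sink) tt).
  constructor; exists (apex K) (leg K cospan_left) (leg K cospan_right).
  apply pullback_intro.
  - exact (eq_trans Hl (eq_sym Hr)).
  - intros x h k e.
    destruct (HK (cospan_cone e)) as [u [Hu _]].
    exists u; split; [exact (Hu cospan_left) | exact (Hu cospan_right)].
  - intros x u v e1 e2; apply (limit_ext HK); intros []; [exact e1 | exact e2 |].
    change (leg K cospan_sink ∘ u = leg K cospan_sink ∘ v).
    rewrite <- Hl; assoc; exact (f_equal (fun w => f ∘ w) e1).
Qed.

Lemma finite_limits_pullback (a b c : C) (f : Hom a c) (g : Hom b c) :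
  exists (p : C) (p1 : Hom p a) (p2 : Hom p b), is_pullback f g p1 p2.
Proof.
  destruct (finite_limits_pullbacks f g) as [[p p1 p2 H]]; now exists p, p1, p2.
Qed.

Lemma finite_limits_product (a b : C) :
  exists (p : C) (p1 : Hom p a) (p2 : Hom p b), is_product p1 p2.
Proof.
  destruct finite_limits_terminal as [t Ht].
  destruct (Ht a) as [ta _], (Ht b) as [tb _].
  destruct (finite_limits_pullback ta tb) as (p & p1 & p2 & _ & H).
  exists p, p1, p2; intros x h k; apply H, (terminal_ext Ht).
Qed.

End FiniteLimits.

(** * Image factorizations in regular categories *)

(** The image is the quotient by the kernel pair; stability of regular
    epimorphisms is what makes the remaining factor a monomorphism. *)
Lemma image_factorization (C : Category) :
  has_finite_limits C -> is_regular C ->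
  forall (a b : C) (f : Hom a b), exists (i : C) (e : Hom a i) (m : Hom i b),
    regular_epi e /\ mono m /\ m ∘ e = f.
Proof.
  intros lim [coeq stable] a b f.
  destruct (finite_limits_pullback lim f f) as (k & p1 & p2 & Hk).
  destruct (coeq _ _ _ _ _ _ Hk) as (i & e & He).
  destruct (proj2 He b f (proj1 Hk)) as [m [Hm _]].
  pose proof (coequalizer_regular_epi He) as Re.
  exists i, e, m; repeat split; [exact Re | | exact Hm].
  intros x u v Huv.
  (* Both generalized elements [u] and [v] lift to [a] over a common cover of
     [x], and the lifts have the same image under [f]. *)
  destruct (finite_limits_pullback lim e u) as (w1 & u' & c1 & P1).
  destruct (finite_limits_pullback lim e (v ∘ c1)) as (w2 & v' & c2 & P2).
  pose proof (regular_epi_epi (stable _ _ _ _ _ _ _ _ P1 Re)) as E1.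
  pose proof (regular_epi_epi (stable _ _ _ _ _ _ _ _ P2 Re)) as E2.
  assert (Hl : f ∘ (u' ∘ c2) = f ∘ v').
  { rewrite <- Hm; crw (proj1 P1); crw (proj1 P2).
    rewrite !comp_assoc; now rewrite Huv. }
  destruct (pullback_lift Hk Hl) as [d [Hd1 Hd2]].
  apply E1, E2.
  rewrite <- (proj1 P1), <- (proj1 P2), <- Hd2; assoc; rewrite <- Hd1.
  rewrite !comp_assoc; now rewrite (proj1 He).
Qed.

(** * Protomodularity and the Mal'tsev property *)

(** The part of protomodularity that remains once pullbacks are not chosen and
    points are not packaged into a category.  In this form it can be applied to
    concrete pullback squares and transported along functors. *)
Definition isos_of_points_local (C : Category) : Prop :=
  forall (b' b a a' : C) (v : Hom b' b)
    (α : Hom a b) (β : Hom b a) (α' : Hom a' b) (β' : Hom b a') (f : Hom a a')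
    (p p' : C) (p1 : Hom p b') (p2 : Hom p a) (q1 : Hom p' b') (q2 : Hom p' a')
    (g : Hom p p'),
  α ∘ β = idm b -> α' ∘ β' = idm b -> α' ∘ f = α -> f ∘ β = β' ->
  is_pullback v α p1 p2 -> is_pullback v α' q1 q2 ->
  q1 ∘ g = p1 -> q2 ∘ g = f ∘ p2 -> is_iso g -> is_iso f.

Lemma point_iso (C : Category) (b : C) (x y : Pt b) (f : Hom x y) :
  is_iso f <-> is_iso (pt_map f).
Proof.
  split.
  - intros [g [H1 H2]]; exists (pt_map g); split;
      [exact (f_equal (@pt_map _ _ _ _) H1) | exact (f_equal (@pt_map _ _ _ _) H2)].
  - intros Hi; pose proof (iso_mono Hi) as Hm; destruct Hi as [g [H1 H2]].
    unshelve eexists {| pt_map := g |}.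
    + rewrite <- (pt_map_proj f); crw H2; reflexivity.
    + apply Hm; rewrite pt_map_sec; crw H2; reflexivity.
    + split; apply PointHom_eq; assumption.
Qed.

Lemma protomodular_isos_of_points (C : Category) :
  protomodular C <-> has_pullbacks C /\ isos_of_points_local C.
Proof.
  split.
  - intros [P HP]; split; [exact P |].
    intros b' b a a' v α β α' β' f p p' p1 p2 q1 q2 g Hβ Hβ' Hfα Hfβ Hp Hq G1 G2 Hg.
    set (x := {| pt_obj := a; pt_proj := α; pt_sec := β; pt_split := Hβ |}).
    set (y := {| pt_obj := a'; pt_proj := α'; pt_sec := β'; pt_split := Hβ' |}).
    set (F := @Build_PointHom C b x y f Hfα Hfβ).
    apply (proj1 (@point_iso C b x y F)), (HP b' b v), point_iso.
    destruct (pullback_comparison Hp (pb_is_pullback (pbv P v x)))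
      as (i & Hi & I1 & I2).
    destruct (pullback_comparison (pb_is_pullback (pbv P v y)) Hq)
      as (j & Hj & J1 & J2).
    replace (pt_map (fmap (change_of_base P v) F)) with (j ∘ (g ∘ i)).
    { now repeat apply iso_comp. }
    simpl; apply pb_hom_ext.
    + rewrite pb_fst_lift; crw J1; crw G1; exact I1.
    + rewrite pb_snd_lift; crw J2; crw G2; exact (f_equal (fun w => f ∘ w) I2).
  - intros [P HP]; exists P; intros b' b v x y f Hf.
    apply point_iso; apply point_iso in Hf.
    refine (HP _ _ _ _ _ _ _ _ _ _ _ _ _ _ _ _ _ (pt_split x) (pt_split y)
      (pt_map_proj f) (pt_map_sec f) (pb_is_pullback (pbv P v x))
      (pb_is_pullback (pbv P v y)) _ _ Hf); simpl.
    + apply pb_fst_lift.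
    + apply pb_snd_lift.
Qed.

(** Let [P] be the object of all triples [(a, b, c)] of elements of [r] as in the
    hypotheses, and [S] the part of [P] on which the conclusion holds.  Over the
    kernel pair of [r2], whose elements are the pairs [(a, b)], both are points,
    with section [(a, b) |-> (a, b, b)].  Restricted along the diagonal
    [b |-> (b, b)] they agree, because [(b, b, c)] always lies in [S]: there [d]
    can be taken to be [c].  By protomodularity they agree altogether. *)
Lemma protomodular_difunctional (C : Category) (r x : C) (r1 r2 : Hom r x) :
  has_finite_limits C -> isos_of_points_local C -> is_relation r1 r2 ->
  forall (w : C) (a b c : Hom w r), r2 ∘ a = r2 ∘ b -> r1 ∘ b = r1 ∘ c ->
    exists d : Hom w r, r1 ∘ d = r1 ∘ a /\ r2 ∘ d = r2 ∘ c.
Proof.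
  intros lim pm rel w a b c Hab Hbc.
  destruct (finite_limits_pullback lim r2 r2) as (K & k1 & k2 & HK).
  destruct (finite_limits_pullback lim r1 r1) as (L & l1 & l2 & HL).
  destruct (finite_limits_pullback lim k2 l1) as (P & p1 & p2 & HP).
  destruct (finite_limits_product lim x x) as (X & x1 & x2 & HX).
  destruct (product_lift HX r1 r2) as [ρ [ρ1 ρ2]].
  destruct (product_lift HX (r1 ∘ (k1 ∘ p1)) (r2 ∘ (l2 ∘ p2))) as [π [π1 π2]].
  destruct (finite_limits_pullback lim π ρ) as (S & s1 & s2 & HS).
  assert (Hs1 : r1 ∘ s2 = r1 ∘ (k1 ∘ (p1 ∘ s1)))
    by (rewrite <- ρ1 at 1; crw <- (proj1 HS); crw π1; reflexivity).
  assert (Hs2 : r2 ∘ s2 = r2 ∘ (l2 ∘ (p2 ∘ s1)))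
    by (rewrite <- ρ2 at 1; crw <- (proj1 HS); crw π2; reflexivity).
  assert (monoS : mono s1).
  { apply (pullback_mono HS); intros z u v e; apply rel;
      [rewrite <- ρ1 | rewrite <- ρ2]; assoc; now rewrite e. }
  assert (intoS : forall (z : C) (h : Hom z P) (d : Hom z r),
    r1 ∘ d = r1 ∘ (k1 ∘ (p1 ∘ h)) -> r2 ∘ d = r2 ∘ (l2 ∘ (p2 ∘ h)) ->
    exists u, s1 ∘ u = h /\ s2 ∘ u = d).
  { intros z h d e1 e2; apply (pullback_lift HS), (product_ext HX).
    - crw π1; crw ρ1; now rewrite e1.
    - crw π2; crw ρ2; now rewrite e2. }
  destruct (kernel_pair_diagonal HK) as [δ [δ1 δ2]].
  destruct (kernel_pair_diagonal HL) as [ε [ε1 ε2]].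
  (* the sections of the two points over [K] *)
  destruct (pullback_lift HP (h := idm K) (k := ε ∘ k2)) as [σ [σ1 σ2]].
  { crw ε1; reflexivity. }
  destruct (intoS K σ k1) as [τ [τ1 τ2]].
  { crw σ1; reflexivity. }
  { crw σ2; crw ε2; exact (proj1 HK). }
  (* both restrictions along [δ] are [L], via [(b, c) |-> (b, b, c)] *)
  destruct (pullback_lift HP (h := δ ∘ l1) (k := idm L)) as [m [m1 m2]].
  { crw δ2; reflexivity. }
  destruct (intoS L m l2) as [n [n1 n2]].
  { rewrite m1; crw δ1; now rewrite (proj1 HL). }
  { rewrite m2; now rewrite comp_id_r. }
  assert (HmP : is_pullback δ p1 l1 m).
  { apply pullback_intro.
    - symmetry; exact m1.
    - intros z h k e; exists (p2 ∘ k); split.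
      + crw <- (proj1 HP); crw <- e; crw δ2; reflexivity.
      + apply (pullback_ext HP); [| crw m2; reflexivity].
        crw m1; crw <- (proj1 HP); crw <- e; crw δ2; reflexivity.
    - intros z u v _ e; rewrite <- (comp_id_l u), <- (comp_id_l v), <- m2.
      assoc; now rewrite e. }
  assert (HnS : is_pullback δ (p1 ∘ s1) l1 n).
  { apply pullback_intro.
    - crw n1; symmetry; exact m1.
    - intros z h k e; rewrite <- comp_assoc in e.
      destruct (pullback_lift HmP e) as [u [Hu1 Hu2]]; exists u.
      split; [exact Hu1 | apply monoS; crw n1; exact Hu2].
    - intros z u v e e'; apply (pullback_ext HmP); [exact e |].
      rewrite <- n1; assoc; now rewrite e'. }
  assert (Hi : is_iso s1).
  { refine (pm _ _ _ _ δ (p1 ∘ s1) τ p1 σ s1 _ _ l1 n l1 m (idm L)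
              _ σ1 eq_refl τ1 HnS HmP (comp_id_r _) _ (iso_id L)).
    - crw τ1; exact σ1.
    - rewrite n1; apply comp_id_r. }
  destruct Hi as [j [_ Hj]].
  destruct (pullback_lift HK Hab) as [ab [ab1 ab2]].
  destruct (pullback_lift HL Hbc) as [bc [bc1 bc2]].
  destruct (pullback_lift HP (h := ab) (k := bc)) as [abc [Habc1 Habc2]].
  { now rewrite ab2, bc1. }
  exists (s2 ∘ (j ∘ abc)); split.
  - crw Hs1; crw Hj; rewrite Habc1, ab1; reflexivity.
  - crw Hs2; crw Hj; rewrite Habc2, bc2; reflexivity.
Qed.

Lemma reflexive_relation_equivalence (C : Category) (r a : C) (r1 r2 : Hom r a)
    (d : Hom a r) :
  has_finite_limits C -> isos_of_points_local C -> is_relation r1 r2 ->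
  r1 ∘ d = idm a -> r2 ∘ d = idm a -> is_equivalence_relation r1 r2.
Proof.
  intros lim pm rel d1 d2; split; [exact rel |]; split; [now exists d | split].
  - (* [y R y], [x R y], [x R x] give [y R x] *)
    destruct (protomodular_difunctional lim pm rel (a := d ∘ r2) (b := idm r)
                (c := d ∘ r1)) as [s [Hs1 Hs2]].
    + crw d2; reflexivity.
    + crw d1; reflexivity.
    + exists s; rewrite Hs1, Hs2; split; [crw d1 | crw d2]; reflexivity.
  - (* [x R y], [y R y], [y R z] give [x R z] *)
    intros p p1 p2 Hp.
    apply (protomodular_difunctional lim pm rel (a := p1) (b := d ∘ (r2 ∘ p1))).
    + crw d2; reflexivity.
    + crw d1; exact (proj1 Hp).
Qed.

(** The image of a reflexive pair in [a × a] is a reflexive relation, hence an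
    equivalence relation, hence the kernel pair of its quotient, and this
    quotient is the coequalizer of the pair.  The factorization through a kernel
    pair is kept in the conclusion because it is what exact functors preserve. *)
Lemma reflexive_pair_quotient (C : Category) (k a : C) (g h : Hom k a)
    (s : Hom a k) :
  barr_exact C -> isos_of_points_local C -> g ∘ s = idm a -> h ∘ s = idm a ->
  exists (r q : C) (c : Hom k r) (r1 r2 : Hom r a) (e : Hom a q),
    regular_epi c /\ r1 ∘ c = g /\ r2 ∘ c = h /\
    is_kernel_pair e r1 r2 /\ is_coequalizer r1 r2 e.
Proof.
  intros (lim & reg & eff) pm Hg Hh.
  destruct (finite_limits_product lim a a) as (A & x1 & x2 & HA).
  destruct (product_lift HA g h) as [gh [Hgh1 Hgh2]].
  destruct (image_factorization lim reg gh) as (r & c & m & Hc & Hm & Hcm).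
  assert (E1 : (x1 ∘ m) ∘ c = g) by (crw Hcm; exact Hgh1).
  assert (E2 : (x2 ∘ m) ∘ c = h) by (crw Hcm; exact Hgh2).
  assert (Hr : is_equivalence_relation (x1 ∘ m) (x2 ∘ m)).
  { apply (@reflexive_relation_equivalence C r a _ _ (c ∘ s)); trivial.
    - intros z u v e1 e2; apply Hm, (product_ext HA); rewrite !comp_assoc; assumption.
    - now rewrite comp_assoc, E1.
    - now rewrite comp_assoc, E2. }
  destruct (eff _ _ _ _ Hr) as (b & f & Hf).
  destruct (proj1 reg _ _ _ _ _ _ Hf) as (q & e & He).
  exists r, q, c, (x1 ∘ m), (x2 ∘ m), e; repeat split; trivial; try apply He.
  apply (coequalizer_kernel_pair Hf He).
Qed.

Definition is_reflexive_pair (C : Category) (k a : C) (g h : Hom k a) : Prop :=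
  exists s : Hom a k, g ∘ s = idm a /\ h ∘ s = idm a.

Definition has_reflexive_coequalizers (C : Category) : Prop :=
  forall (k a : C) (g h : Hom k a), is_reflexive_pair g h ->
    exists (q : C) (e : Hom a q), is_coequalizer g h e.

Definition preserves_reflexive_coequalizers (C D : Category) (F : Functor C D) : Prop :=
  forall (k a q : C) (g h : Hom k a) (e : Hom a q), is_reflexive_pair g h ->
    is_coequalizer g h e -> is_coequalizer (fmap F g) (fmap F h) (fmap F e).

Lemma exact_protomodular_reflexive_coequalizers (C : Category) :
  barr_exact C -> isos_of_points_local C -> has_reflexive_coequalizers C.
Proof.
  intros ex pm k a g h (s & Hg & Hh).
  destruct (reflexive_pair_quotient ex pm Hg Hh)
    as (r & q & c & r1 & r2 & e & Hc & <- & <- & _ & He).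
  exists q, e; exact (coequalizer_precomp_epi (regular_epi_epi Hc) He).
Qed.

Lemma functor_iso (C D : Category) (F : Functor C D) (a b : C) (f : Hom a b) :
  is_iso f -> is_iso (fmap F f).
Proof.
  intros [g [H1 H2]]; exists (fmap F g); rewrite <- !fmap_comp, H1, H2.
  now rewrite !fmap_id.
Qed.

(** Such a functor preserves both steps of the construction of the coequalizer:
    the cover of the image relation, and the quotient by that relation. *)
Lemma exact_functor_reflexive_coequalizers (C D : Category) (F : Functor C D) :
  barr_exact C -> isos_of_points_local C ->
  preserves_regular_epis F -> preserves_kernel_pairs F ->
  preserves_reflexive_coequalizers F.
Proof.
  intros ex pm Fre Fkp k a q g h f (s & Hg & Hh) Hf.
  destruct (reflexive_pair_quotient ex pm Hg Hh)
    as (r & q' & c & r1 & r2 & e & Hc & <- & <- & Hk & He).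
  destruct (coequalizer_unique
              (coequalizer_precomp_epi (regular_epi_epi Hc) He) Hf) as (i & Hi & <-).
  rewrite !fmap_comp; apply coequalizer_iso; [| now apply functor_iso].
  apply coequalizer_precomp_epi; [now apply regular_epi_epi, Fre |].
  apply regular_epi_coequalizer; [| now apply Fkp].
  apply Fre, (coequalizer_regular_epi He).
Qed.

(** * Transfer of exactness along a functor *)

Definition preserves_pullbacks (A X : Category) (U : Functor A X) : Prop :=
  forall (a b c p : A) (f : Hom a c) (g : Hom b c) (p1 : Hom p a) (p2 : Hom p b),
    is_pullback f g p1 p2 ->
    is_pullback (fmap U f) (fmap U g) (fmap U p1) (fmap U p2).

Definition preserves_relations (A X : Category) (U : Functor A X) : Prop :=
  forall (r a : A) (r1 r2 : Hom r a),
    is_relation r1 r2 -> is_relation (fmap U r1) (fmap U r2).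

Definition lifts_quotients (A X : Category) (U : Functor A X) : Prop :=
  forall (r a : A) (r1 r2 : Hom r a) (y : X) (f : Hom (U a) y),
    is_kernel_pair f (fmap U r1) (fmap U r2) ->
    is_coequalizer (fmap U r1) (fmap U r2) f ->
    exists (q : A) (e : Hom a q),
      is_coequalizer r1 r2 e /\
      is_coequalizer (fmap U r1) (fmap U r2) (fmap U e).

Lemma preserves_pullbacks_kernel_pairs (A X : Category) (U : Functor A X) :
  preserves_pullbacks U -> preserves_kernel_pairs U.
Proof. intros H a b k f p1 p2; apply H. Qed.

(** What the forgetful functors of slice categories and of categories of
    algebras have in common.  Preservation of all finite limits would be too much
    to ask, as slices have other products than the base; pullbacks and jointly
    monic pairs are what regularity and equivalence relations are made of. *)
Record exactness_reflecting (A X : Category) (U : Functor A X) : Prop := {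
  er_limits : has_finite_limits A;
  er_pullbacks : preserves_pullbacks U;
  er_relations : preserves_relations U;
  er_isos : reflects_isos U;
  er_quotients : lifts_quotients U
}.

Section Transfer.

Variables (A X : Category) (U : Functor A X).
Hypothesis HU : exactness_reflecting U.

Lemma reflects_pullbacks (a b c p : A) (f : Hom a c) (g : Hom b c)
    (p1 : Hom p a) (p2 : Hom p b) :
  f ∘ p1 = g ∘ p2 ->
  is_pullback (fmap U f) (fmap U g) (fmap U p1) (fmap U p2) ->
  is_pullback f g p1 p2.
Proof.
  intros sq HP.
  destruct (finite_limits_pullback (er_limits HU) f g) as (k & k1 & k2 & Hk).
  destruct (pullback_lift Hk sq) as [i [<- <-]].
  apply (pullback_of_iso Hk), (er_isos HU).
  destruct (pullback_comparison (er_pullbacks HU Hk) HP) as (j & Hj & J1 & J2).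
  replace (fmap U i) with j; [exact Hj |].
  apply (pullback_ext (er_pullbacks HU Hk)); now rewrite <- fmap_comp.
Qed.

Lemma kernel_pair_quotient (r a : A) (r1 r2 : Hom r a) (b : A)
    (f : Hom a b) :
  is_regular X -> is_kernel_pair f r1 r2 ->
  exists (q : A) (e : Hom a q),
    is_coequalizer r1 r2 e /\ is_coequalizer (fmap U r1) (fmap U r2) (fmap U e).
Proof.
  intros reg Hk; pose proof (er_pullbacks HU Hk) as HUk.
  destruct (proj1 reg _ _ _ _ _ _ HUk) as (y & e & He).
  exact (er_quotients HU (coequalizer_kernel_pair HUk He) He).
Qed.

(** A regular epimorphism is the quotient of its kernel pair, in [A] as in [X],
    and [U] matches the two quotients. *)
Lemma regular_epi_transfer (a b : A) (f : Hom a b) :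
  is_regular X -> regular_epi f <-> regular_epi (fmap U f).
Proof.
  intros reg.
  destruct (finite_limits_pullback (er_limits HU) f f) as (r & r1 & r2 & Hr).
  destruct (kernel_pair_quotient reg Hr) as (q & e & He & HUe).
  split; intros Hf.
  - destruct (coequalizer_unique He (regular_epi_coequalizer Hf Hr)) as (i & Hi & <-).
    rewrite fmap_comp; apply regular_epi_iso; [| now apply functor_iso].
    exact (coequalizer_regular_epi HUe).
  - destruct (proj2 He b f (proj1 Hr)) as [i [<- _]].
    apply regular_epi_iso; [exact (coequalizer_regular_epi He) |].
    apply (er_isos HU).
    destruct (coequalizer_unique HUe
                (regular_epi_coequalizer Hf (er_pullbacks HU Hr))) as (j & Hj & Ej).
    replace (fmap U i) with j; [exact Hj |].
    apply (coequalizer_epi HUe); now rewrite Ej, fmap_comp.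
Qed.

Lemma regular_transfer : is_regular X -> is_regular A.
Proof.
  intros reg; split.
  - intros a b k f p1 p2 Hk.
    destruct (kernel_pair_quotient reg Hk) as (q & e & He & _).
    now exists q, e.
  - intros a b c p f g p1 p2 Hp Hf; apply (regular_epi_transfer _ reg).
    apply (proj2 reg _ _ _ _ _ _ _ _ (er_pullbacks HU Hp)).
    now apply regular_epi_transfer.
Qed.

Lemma equivalence_relation_transfer (r a : A) (r1 r2 : Hom r a) :
  is_equivalence_relation r1 r2 ->
  is_equivalence_relation (fmap U r1) (fmap U r2).
Proof.
  intros (rel & (d & d1 & d2) & (s & s1 & s2) & tr).
  split; [now apply (er_relations HU) |]; split; [| split].
  - exists (fmap U d); rewrite <- !fmap_comp, d1, d2, fmap_id; now split.
  - exists (fmap U s); rewrite <- !fmap_comp, s1, s2; now split.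
  - intros p p1 p2 Hp.
    destruct (finite_limits_pullback (er_limits HU) r2 r1) as (k & k1 & k2 & Hk).
    destruct (tr k k1 k2 Hk) as [t [t1 t2]].
    destruct (pullback_lift (er_pullbacks HU Hk) (proj1 Hp)) as [i [i1 i2]].
    exists (fmap U t ∘ i); rewrite !comp_assoc, <- !fmap_comp, t1, t2, !fmap_comp.
    rewrite <- i1, <- i2, !comp_assoc; now split.
Qed.

(** An equivalence relation in [A] becomes effective in [X]; its quotient lifts,
    and the pullback square exhibiting it as a kernel pair is reflected. *)
Lemma barr_exact_transfer : barr_exact X -> barr_exact A.
Proof.
  intros (lim & reg & eff); split; [exact (er_limits HU) |].
  split; [now apply regular_transfer |].
  intros r a r1 r2 Hr.
  destruct (eff _ _ _ _ (equivalence_relation_transfer Hr)) as (b & f & Hf).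
  destruct (proj1 reg _ _ _ _ _ _ Hf) as (y & e & He).
  destruct (er_quotients HU (coequalizer_kernel_pair Hf He) He)
    as (q & e' & He' & HUe').
  exists q, e'; apply reflects_pullbacks; [exact (proj1 He') |].
  exact (coequalizer_kernel_pair Hf HUe').
Qed.

End Transfer.

(** Protomodularity only speaks of pullbacks and of isomorphisms. *)
Lemma protomodular_transfer (A X : Category) (U : Functor A X) :
  has_pullbacks A -> preserves_pullbacks U -> reflects_isos U ->
  protomodular X -> protomodular A.
Proof.
  intros PA Upb Uiso pm; apply protomodular_isos_of_points; split; [exact PA |].
  apply protomodular_isos_of_points in pm; destruct pm as [_ pm].
  intros b' b a a' v α β α' β' f p p' p1 p2 q1 q2 g E1 E2 E3 E4 Hp Hq E5 E6 Hg.
  apply Uiso.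
  apply (pm _ _ _ _ _ (fmap U α) (fmap U β) (fmap U α') (fmap U β') (fmap U f)
    _ _ _ _ _ _ (fmap U g)) with (5 := Upb _ _ _ _ _ _ _ _ Hp)
      (6 := Upb _ _ _ _ _ _ _ _ Hq); try now apply functor_iso.
  all: rewrite <- !fmap_comp, <- ?fmap_id; now f_equal.
Qed.

(** * Equivalences of categories *)

Definition fully_faithful (C D : Category) (K : Functor C D) : Prop :=
  forall (a b : C) (h : Hom (K a) (K b)), exists! f : Hom a b, fmap K f = h.

Definition essentially_surjective (C D : Category) (K : Functor C D) : Prop :=
  forall d : D, exists (a : C) (i : Hom (K a) d), is_iso i.

Lemma faithful (C D : Category) (K : Functor C D) : fully_faithful K ->
  forall (a b : C) (f g : Hom a b), fmap K f = fmap K g -> f = g.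
Proof.
  intros ff a b f g e; destruct (ff a b (fmap K g)) as [w [_ Hw]].
  now rewrite <- (Hw f e), <- (Hw g eq_refl).
Qed.

Lemma full (C D : Category) (K : Functor C D) : fully_faithful K ->
  forall (a b : C) (h : Hom (K a) (K b)), exists f : Hom a b, fmap K f = h.
Proof. intros ff a b h; destruct (ff a b h) as [f [Hf _]]; now exists f. Qed.

Lemma fully_faithful_reflects_isos (C D : Category) (K : Functor C D) :
  fully_faithful K -> reflects_isos K.
Proof.
  intros ff a b f [h [H1 H2]]; destruct (full ff h) as [g <-]; exists g.
  split; apply (faithful ff); rewrite fmap_comp, fmap_id; assumption.
Qed.

Lemma left_inverse_faithful (C D : Category) (K : Functor C D) (G : Functor D C)
    (t : NatTrans (comp_functor G K) (id_functor C)) :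
  (forall a, is_iso (t a)) ->
  forall (a b : C) (f g : Hom a b), fmap K f = fmap K g -> f = g.
Proof.
  intros Ht a b f g e; apply (iso_epi (Ht a)).
  transitivity (t b ∘ fmap G (fmap K f)); [symmetry; exact (naturality t f) |].
  rewrite e; exact (naturality t g).
Qed.

Section Equivalence.

Variables (C D : Category) (K : Functor C D).

Lemma equivalence_fully_faithful : is_equivalence K -> fully_faithful K.
Proof.
  intros (G & [t Ht] & [s Hs]).
  pose proof (left_inverse_faithful Ht) as Kf.
  pose proof (left_inverse_faithful Hs) as Gf.
  destruct t as [t N]; simpl in t, N, Ht.
  intros a b h; destruct (Ht a) as (ta & Ha1 & Ha2).
  exists (t b ∘ fmap G h ∘ ta); split.
  - apply Gf, (iso_mono (Ht b)); simpl.
    rewrite N; crw Ha1; reflexivity.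
  - intros f <-; apply (iso_epi (Ht a)); crw Ha1; apply N.
Qed.

Lemma equivalence_essentially_surjective :
  is_equivalence K -> essentially_surjective K.
Proof.
  intros (G & _ & [s Hs]) d; exists (G d), (s d); apply Hs.
Qed.

(** A choice of preimages under [K] is made into a functor by full
    faithfulness. *)
Section Inverse.

Hypothesis ff : fully_faithful K.
Hypothesis eso : essentially_surjective K.

Definition inv_obj (d : D) : C :=
  proj1_sig (constructive_indefinite_description _ (eso d)).

Definition inv_counit (d : D) : Hom (K (inv_obj d)) d :=
  proj1_sig (constructive_indefinite_description _
    (proj2_sig (constructive_indefinite_description _ (eso d)))).

Lemma inv_counit_iso (d : D) : is_iso (inv_counit d).
Proof.
  exact (proj2_sig (constructive_indefinite_description _
    (proj2_sig (constructive_indefinite_description _ (eso d))))).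
Qed.

Lemma inv_map_ex (d d' : D) (f : Hom d d') :
  exists g : Hom (inv_obj d) (inv_obj d'),
    inv_counit d' ∘ fmap K g = f ∘ inv_counit d.
Proof.
  destruct (inv_counit_iso d') as (j & _ & Hj).
  destruct (full ff (j ∘ (f ∘ inv_counit d))) as [g Hg].
  exists g; rewrite Hg; crw Hj; reflexivity.
Qed.

Definition inv_map (d d' : D) (f : Hom d d') : Hom (inv_obj d) (inv_obj d') :=
  proj1_sig (constructive_indefinite_description _ (inv_map_ex f)).

Lemma inv_map_counit (d d' : D) (f : Hom d d') :
  inv_counit d' ∘ fmap K (inv_map f) = f ∘ inv_counit d.
Proof.
  exact (proj2_sig (constructive_indefinite_description _ (inv_map_ex f))).
Qed.

Lemma inv_map_unique (d d' : D) (g g' : Hom (inv_obj d) (inv_obj d')) :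
  inv_counit d' ∘ fmap K g = inv_counit d' ∘ fmap K g' -> g = g'.
Proof. intros e; apply (faithful ff), (iso_mono (inv_counit_iso d')), e. Qed.

Definition inv_functor : Functor D C.
Proof.
  refine {| fobj := inv_obj; fmap := inv_map |}.
  - intros d; apply inv_map_unique.
    now rewrite inv_map_counit, fmap_id, comp_id_l, comp_id_r.
  - intros d d' d'' g f; apply inv_map_unique.
    rewrite inv_map_counit, fmap_comp, comp_assoc, inv_map_counit.
    crw (inv_map_counit f); reflexivity.
Defined.

Lemma fully_faithful_eso_equivalence : is_equivalence K.
Proof.
  exists inv_functor; split.
  - assert (H : forall a : C, exists u : Hom (inv_obj (K a)) a,
               fmap K u = inv_counit (K a)) by (intros a; apply (full ff)).
    set (u := fun a => proj1_sig (constructive_indefinite_description _ (H a))).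
    assert (Hu : forall a, fmap K (u a) = inv_counit (K a)) by
      (intros a; exact (proj2_sig (constructive_indefinite_description _ (H a)))).
    unshelve eexists.
    + exists u; intros a b f; apply (faithful ff); simpl.
      rewrite !fmap_comp, !Hu; apply inv_map_counit.
    + intros a; apply (fully_faithful_reflects_isos ff); simpl.
      rewrite Hu; apply inv_counit_iso.
  - unshelve eexists.
    + exists inv_counit; intros d d' f; apply inv_map_counit.
    + exact inv_counit_iso.
Qed.

Lemma equivalence_finite_limits : has_finite_limits D -> has_finite_limits C.
Proof.
  intros lim J HJ F.
  destruct (lim J HJ (comp_functor K F)) as [L HL].
  destruct (eso (apex L)) as (l & i & Hi).
  assert (Hleg : forall j : J, exists h : Hom l (F j), fmap K h = leg L j ∘ i)
    by (intros j; apply (full ff)).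
  set (ℓ := fun j => proj1_sig (constructive_indefinite_description _ (Hleg j))).
  assert (Hℓ : forall j, fmap K (ℓ j) = leg L j ∘ i) by
    (intros j; exact (proj2_sig (constructive_indefinite_description _ (Hleg j)))).
  unshelve eexists {| apex := l; leg := ℓ |}.
  { intros j j' u; apply (faithful ff); rewrite fmap_comp, !Hℓ, comp_assoc.
    f_equal; exact (leg_natural L u). }
  intros M.
  destruct (HL (map_cone K M)) as [m [Hm Hm']].
  simpl in m, Hm, Hm'.
  pose proof (iso_mono Hi) as mi; destruct Hi as (i' & I1 & I2).
  destruct (full ff (i' ∘ m)) as [w Hw].
  exists w; simpl; split.
  - intros j; apply (faithful ff); rewrite fmap_comp, Hℓ, Hw.
    crw I2; exact (Hm j).
  - intros w' Hw''; apply (faithful ff), mi; rewrite Hw; crw I2.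
    apply Hm'; intros j; rewrite <- (Hw'' j), fmap_comp, Hℓ; apply comp_assoc.
Qed.

Lemma equivalence_lifts_coequalizers (k a : C) (g h : Hom k a) (d : D)
    (e : Hom (K a) d) :
  is_coequalizer (fmap K g) (fmap K h) e ->
  exists (q : C) (f : Hom a q) (i : Hom d (K q)),
    is_coequalizer g h f /\ is_iso i /\ fmap K f = i ∘ e.
Proof.
  intros He; destruct (eso d) as (q & j & i & J1 & J2).
  destruct (full ff (i ∘ e)) as [f Hf].
  assert (Hi : is_iso i) by (exists j; now split).
  exists q, f, i; split; [| now split].
  pose proof (coequalizer_iso He Hi) as HKf; rewrite <- Hf in HKf; split.
  - apply (faithful ff); rewrite !fmap_comp; apply HKf.
  - intros y c Hc; destruct (proj2 HKf (K y) (fmap K c)) as [u [Hu Hu']].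
    { rewrite <- !fmap_comp; now rewrite Hc. }
    destruct (full ff u) as [w <-]; exists w; split.
    + apply (faithful ff); now rewrite fmap_comp.
    + intros w' Hw'; apply (faithful ff), Hu'; now rewrite <- fmap_comp, Hw'.
Qed.

End Inverse.

End Equivalence.

(** * Adjunctions and monadicity *)

Section AdjunctionFacts.

Variables (X A : Category) (F : Functor X A) (U : Functor A X).
Variable adj : Adjunction F U.

(** The components of unit and counit, at types in which the identity and
    composite functors have been reduced away. *)
Definition unit_at (x : X) : Hom x (U (F x)) := adj_unit adj x.
Definition counit_at (a : A) : Hom (F (U a)) a := adj_counit adj a.

Local Notation η := unit_at.
Local Notation ε := counit_at.

Definition transpose (x : X) (a : A) (f : Hom (F x) a) : Hom x (U a) :=
  fmap U f ∘ η x.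

Definition untranspose (x : X) (a : A) (h : Hom x (U a)) : Hom (F x) a :=
  ε a ∘ fmap F h.

Lemma unit_natural (x y : X) (h : Hom x y) :
  η y ∘ h = fmap U (fmap F h) ∘ η x.
Proof. exact (naturality (adj_unit adj) h). Qed.

Lemma counit_natural (a b : A) (f : Hom a b) :
  ε b ∘ fmap F (fmap U f) = f ∘ ε a.
Proof. exact (naturality (adj_counit adj) f). Qed.

Lemma triangle_F (x : X) : ε (F x) ∘ fmap F (η x) = idm (F x).
Proof. exact (adj_triangle_l adj x). Qed.

Lemma triangle_U (a : A) : fmap U (ε a) ∘ η (U a) = idm (U a).
Proof. exact (adj_triangle_r adj a). Qed.

Lemma untransposeK (x : X) (a : A) (h : Hom x (U a)) :
  transpose (untranspose h) = h.
Proof.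
  unfold transpose, untranspose; rewrite fmap_comp; crw <- (unit_natural h).
  crw (triangle_U a); reflexivity.
Qed.

Lemma transposeK (x : X) (a : A) (f : Hom (F x) a) :
  untranspose (transpose f) = f.
Proof.
  unfold transpose, untranspose; rewrite fmap_comp; crw (counit_natural f).
  crw (triangle_F x); reflexivity.
Qed.

Lemma transpose_inj (x : X) (a : A) (f g : Hom (F x) a) :
  transpose f = transpose g -> f = g.
Proof. intros e; rewrite <- (transposeK f), <- (transposeK g); now f_equal. Qed.

Lemma transpose_comp (x : X) (a b : A) (g : Hom a b) (f : Hom (F x) a) :
  transpose (g ∘ f) = fmap U g ∘ transpose f.
Proof. unfold transpose; now rewrite fmap_comp, comp_assoc. Qed.

Lemma untranspose_comp (x : X) (a b : A) (g : Hom a b) (h : Hom x (U a)) :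
  untranspose (fmap U g ∘ h) = g ∘ untranspose h.
Proof. apply transpose_inj; now rewrite transpose_comp, !untransposeK. Qed.

Lemma untranspose_inj (x : X) (a : A) (f g : Hom x (U a)) :
  untranspose f = untranspose g -> f = g.
Proof. intros e; rewrite <- (untransposeK f), <- (untransposeK g); now f_equal. Qed.

Lemma right_adjoint_preserves_pullbacks : preserves_pullbacks U.
Proof.
  intros a b c p f g p1 p2 H; apply pullback_intro.
  - rewrite <- !fmap_comp; now rewrite (proj1 H).
  - intros x h k e.
    destruct (pullback_lift H (h := untranspose h) (k := untranspose k))
      as [u [U1 U2]]; [rewrite <- !untranspose_comp; now f_equal |].
    exists (transpose u); rewrite <- !transpose_comp, U1, U2.
    now rewrite !untransposeK.
  - intros x u v e1 e2; apply untranspose_inj, (pullback_ext H);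
      rewrite <- !untranspose_comp; now f_equal.
Qed.

Lemma right_adjoint_preserves_relations : preserves_relations U.
Proof.
  intros r a r1 r2 H x u v e1 e2; apply untranspose_inj, H;
    rewrite <- !untranspose_comp; now f_equal.
Qed.

Lemma right_adjoint_preserves_mono (a b : A) (m : Hom a b) :
  mono m -> mono (fmap U m).
Proof.
  intros Hm x u v e; apply untranspose_inj, Hm.
  rewrite <- !untranspose_comp; now f_equal.
Qed.

Lemma right_adjoint_preserves_terminal (t : A) :
  is_terminal t -> is_terminal (U t).
Proof.
  intros Ht x; destruct (Ht (F x)) as [f _]; exists (transpose f).
  split; [exact I |]; intros g _.
  rewrite <- (untransposeK g); f_equal; apply (terminal_ext Ht).
Qed.

Lemma comparison_full (ff : fully_faithful (comparison adj)) (a b : A)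
    (h : Hom (U a) (U b)) :
  h ∘ fmap U (ε a) = fmap U (ε b) ∘ fmap U (fmap F h) ->
  exists f : Hom a b, fmap U f = h.
Proof.
  intros Hh.
  set (h' := @Build_AlgebraHom X (induced_monad adj) (comparison adj a)
               (comparison adj b) h Hh).
  destruct (full ff h') as [f Hf]; exists f.
  exact (f_equal (@alg_map _ _ _ _) Hf).
Qed.

Lemma comparison_faithful (ff : fully_faithful (comparison adj)) (a b : A)
    (f g : Hom a b) : fmap U f = fmap U g -> f = g.
Proof. intros e; apply (faithful ff), AlgebraHom_eq, e. Qed.

Lemma algebra_iso (T : Monad X) (a b : EilenbergMoore T) (f : Hom a b) :
  is_iso (alg_map f) -> is_iso f.
Proof.
  intros Hi; pose proof (iso_mono Hi) as Hm; destruct Hi as (g & H1 & H2).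
  unshelve eexists (@Build_AlgebraHom X T b a g _).
  - apply Hm; rewrite !comp_assoc, H2, alg_map_str, comp_id_l, <- comp_assoc.
    now rewrite <- fmap_comp, H2, fmap_id, comp_id_r.
  - split; apply AlgebraHom_eq; assumption.
Qed.

Lemma comparison_reflects_isos (ff : fully_faithful (comparison adj)) :
  reflects_isos U.
Proof.
  intros a b f Hf; apply (fully_faithful_reflects_isos ff), algebra_iso, Hf.
Qed.

Section CrudeMonadicity.

Hypothesis Uiso : reflects_isos U.
Hypothesis Acoeq : has_reflexive_coequalizers A.
Hypothesis Ucoeq : preserves_reflexive_coequalizers U.

Local Notation T := (induced_monad adj).

Lemma algebra_reflexive_pair (m : Algebra T) :
  is_reflexive_pair (fmap F (alg_str m)) (ε (F (alg_obj m))).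
Proof.
  exists (fmap F (η (alg_obj m))); split; [| apply triangle_F].
  rewrite <- fmap_comp, <- fmap_id; f_equal; exact (alg_unit m).
Qed.

(** The splitting is given by the unit at the object underlying the algebra and
    at the free algebra on it. *)
Lemma algebra_split_coequalizer (m : Algebra T) :
  is_coequalizer (fmap U (fmap F (alg_str m))) (fmap U (ε (F (alg_obj m))))
    (alg_str m).
Proof.
  destruct m as [x ξ Hu Hm]; simpl in *.
  change (ξ ∘ η x = idm x) in Hu.
  change (ξ ∘ fmap U (ε (F x)) = ξ ∘ fmap U (fmap F ξ)) in Hm.
  split; [now symmetry |]; intros y e He; exists (e ∘ η x); split.
  - crw (unit_natural ξ); rewrite comp_assoc, He.
    crw (triangle_U (F x)); reflexivity.
  - intros w <-; crw Hu; reflexivity.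
Qed.

(** The canonical presentation of an algebra by free ones has a coequalizer
    already in [A]; since [U] preserves it, the algebra structure is recovered up
    to isomorphism. *)
Lemma algebra_presentation (m : Algebra T) :
  exists (a : A) (e : Hom (F (alg_obj m)) a) (i : Hom (U a) (alg_obj m)),
    is_coequalizer (fmap F (alg_str m)) (ε (F (alg_obj m))) e /\
    is_iso i /\ i ∘ fmap U e = alg_str m.
Proof.
  pose proof (algebra_reflexive_pair m) as Hr.
  destruct (Acoeq Hr) as (a & e & He).
  destruct (coequalizer_unique (Ucoeq Hr He) (algebra_split_coequalizer m))
    as (i & Hi & E).
  now exists a, e, i.
Qed.

(** The comparison from the coequalizer of the presentation to [a] becomes
    invertible under [U], and [U] reflects isomorphisms. *)
Lemma counit_coequalizer (a : A) :
  is_coequalizer (fmap F (fmap U (ε a))) (ε (F (U a))) (ε a).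
Proof.
  destruct (algebra_presentation (comparison adj a)) as (b & e & i & He & Hi & Ei).
  simpl in b, e, i, He, Hi, Ei.
  destruct (proj2 He a (ε a)) as [m [Hm _]]; [apply counit_natural |].
  assert (Im : is_iso m); [apply Uiso |
    pose proof (coequalizer_iso He Im) as H; rewrite Hm in H; exact H].
  replace (fmap U m) with i; [exact Hi |].
  apply (coequalizer_epi (Ucoeq (algebra_reflexive_pair (comparison adj a)) He)).
  refine (eq_trans Ei _); rewrite <- fmap_comp; exact (f_equal (fmap U) (eq_sym Hm)).
Qed.

(** Full faithfulness of the comparison holds because each counit is the
    coequalizer of its presentation; a preimage of an algebra is the coequalizer
    in [A] of the presentation of that algebra. *)
Theorem crude_monadicity : monadic_adjunction adj.
Proof.
  apply fully_faithful_eso_equivalence.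
  - intros a b [h Hh]; simpl in h, Hh.
    change (h ∘ fmap U (ε a) = fmap U (ε b) ∘ fmap U (fmap F h)) in Hh.
    destruct (proj2 (counit_coequalizer a) b (untranspose h)) as [f [Hf Hf']].
    { unfold untranspose; crw <- (counit_natural (fmap F h)).
      rewrite <- fmap_comp, Hh, fmap_comp, !comp_assoc; f_equal.
      apply counit_natural. }
    assert (E : forall f' : Hom a b, f' ∘ ε a = untranspose (fmap U f'))
      by (intros f'; symmetry; apply counit_natural).
    exists f; split.
    + apply AlgebraHom_eq; apply untranspose_inj; simpl; rewrite <- E; exact Hf.
    + intros f' Hf''; apply Hf'; rewrite E; f_equal.
      exact (f_equal (@alg_map _ _ _ _) Hf'').
  - intros m; destruct (algebra_presentation m) as (a & e & i & He & (j & J1 & J2) & Ei).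
    destruct m as [x ξ Hu Hm]; simpl in ξ, e, i, He, j, J1, J2, Ei, Hu, Hm.
    change (ξ ∘ η x = idm x) in Hu.
    (* the inverse of [i] is an algebra morphism because it is [U e ∘ η] *)
    assert (Hj : j = transpose e).
    { unfold transpose; rewrite <- (comp_id_l (fmap U e)), <- J1.
      crw Ei; rewrite Hu; now rewrite comp_id_r. }
    assert (Hjξ : j ∘ ξ = fmap U (ε a) ∘ fmap U (fmap F j)).
    { rewrite Hj; unfold transpose; crw (unit_natural ξ).
      rewrite comp_assoc, <- fmap_comp, (proj1 He), fmap_comp.
      crw (triangle_U (F x)).
      rewrite <- fmap_comp; fold (transpose e); fold (untranspose (transpose e)).
      now rewrite transposeK. }
    set (m := @Build_Algebra X T x ξ Hu Hm).
    set (J := @Build_AlgebraHom X T m (comparison adj a) j Hjξ).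
    destruct (@algebra_iso T m (comparison adj a) J) as (I & I1 & I2).
    { exists i; now split. }
    exists a, I, J; now split.
Qed.

End CrudeMonadicity.

End AdjunctionFacts.

(** * Exactness of categories of algebras *)

Section AlgebraExactness.

Variables (X : Category) (T : Monad X).

Definition forget_algebra : Functor (EilenbergMoore T) X :=
  {| fobj := fun a : EilenbergMoore T => alg_obj a : X;
     fmap := fun a b (f : @Hom (EilenbergMoore T) a b) => alg_map f;
     fmap_id := fun a => eq_refl;
     fmap_comp := fun a b c g f => eq_refl |}.

(** The legs of the limit in [X], composed with the structures of the diagram,
    form a cone with apex the image of the limit under [T]; the map it induces
    is the structure of the limit. *)
Lemma algebras_finite_limits :
  has_finite_limits X -> has_finite_limits (EilenbergMoore T).
Proof.
  intros lim J HJ D.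
  destruct (lim J HJ (comp_functor forget_algebra D)) as [K HK].
  set (l := apex K).
  set (p := fun j => leg K j : Hom l (alg_obj (D j))).
  set (str := fun j => alg_str (D j)).
  assert (ext : forall (x : X) (u v : Hom x l),
             (forall j, p j ∘ u = p j ∘ v) -> u = v) by exact (limit_ext HK).
  assert (nat : forall i j (w : Hom i j), alg_map (fmap D w) ∘ p i = p j)
    by exact (leg_natural K).
  assert (Hc : forall i j (w : Hom i j),
    alg_map (fmap D w) ∘ (str i ∘ fmap T (p i)) = str j ∘ fmap T (p j)).
  { intros i j w; unfold str; rewrite comp_assoc, alg_map_str.
    rewrite <- comp_assoc, <- fmap_comp; do 2 f_equal; apply nat. }
  destruct (HK (@Build_Cone J X (comp_functor forget_algebra D) (T l)
                  (fun j => str j ∘ fmap T (p j)) Hc)) as [ξ [Hξ _]].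
  change (forall j, p j ∘ ξ = str j ∘ fmap T (p j)) in Hξ; simpl in ξ.
  assert (Hu : ξ ∘ monad_unit T l = idm l).
  { apply ext; intros j.
    pose proof (naturality (monad_unit T) (p j)) as N.
    pose proof (alg_unit (D j)) as Q; simpl in N, Q |- *.
    rewrite comp_assoc, Hξ, <- comp_assoc, <- N, comp_assoc.
    unfold str; now rewrite Q, comp_id_l, comp_id_r. }
  assert (Hm : ξ ∘ monad_mult T l = ξ ∘ fmap T ξ).
  { apply ext; intros j.
    pose proof (naturality (monad_mult T) (p j)) as N.
    pose proof (alg_mult (D j)) as Q; simpl in N, Q |- *.
    rewrite !comp_assoc, Hξ, <- !comp_assoc, <- N, comp_assoc.
    rewrite <- fmap_comp, Hξ, fmap_comp, comp_assoc; now f_equal. }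
  set (L := @Build_Algebra X T l ξ Hu Hm : EilenbergMoore T).
  assert (Hn : forall i j (w : Hom i j),
             fmap D w ∘ (@Build_AlgebraHom X T L (D i) (p i) (Hξ i)
                           : @Hom (EilenbergMoore T) L (D i))
             = @Build_AlgebraHom X T L (D j) (p j) (Hξ j)).
  { intros i j w; apply AlgebraHom_eq; apply nat. }
  exists (@Build_Cone J (EilenbergMoore T) D L _ Hn); intros M.
  destruct (HK (map_cone forget_algebra M)) as [m [Hm1 Hm2]].
  set (mm := m : Hom (alg_obj (apex M)) l).
  assert (Hmm : forall j, p j ∘ mm = alg_map (leg M j)) by exact Hm1.
  assert (Hs : mm ∘ alg_str (apex M) = ξ ∘ fmap T mm).
  { apply ext; intros j; rewrite !comp_assoc, Hmm, Hξ, alg_map_str.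
    now rewrite <- comp_assoc, <- fmap_comp, Hmm. }
  exists (@Build_AlgebraHom X T (apex M) L mm Hs); split.
  - intros j; apply AlgebraHom_eq, Hmm.
  - intros m' Hm'; apply AlgebraHom_eq, Hm2; intros j.
    exact (f_equal (@alg_map _ _ _ _) (Hm' j)).
Qed.

(** [T f] is again the quotient of its kernel pair, so that the structure of [a]
    descends to [y]; the algebra laws hold because [f] and [T (T f)] are
    epimorphisms. *)
Lemma forget_algebra_lifts_quotients :
  preserves_regular_epis T -> preserves_kernel_pairs T ->
  lifts_quotients forget_algebra.
Proof.
  intros Tre Tkp r a r1 r2 y f Hk Hf; simpl in *.
  pose proof (coequalizer_regular_epi Hf) as Rf.
  pose proof (regular_epi_coequalizer (Tre _ _ _ Rf) (Tkp _ _ _ _ _ _ Hk)) as HTf.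
  pose proof (coequalizer_epi HTf) as ETf.
  pose proof (regular_epi_epi (Tre _ _ _ (Tre _ _ _ Rf))) as ETTf.
  pose proof (coequalizer_epi Hf) as Ef.
  destruct (proj2 HTf y (f ∘ alg_str a)) as [ξ [Hξ _]].
  { assoc; rewrite <- !alg_map_str, !comp_assoc; now rewrite (proj1 Hf). }
  assert (Hu : ξ ∘ monad_unit T y = idm y).
  { apply Ef.
    pose proof (naturality (monad_unit T) f) as N.
    pose proof (alg_unit a) as Q; simpl in N, Q |- *.
    rewrite <- comp_assoc, N, comp_assoc, Hξ, <- comp_assoc, Q.
    now rewrite comp_id_l, comp_id_r. }
  assert (Hm : ξ ∘ monad_mult T y = ξ ∘ fmap T ξ).
  { apply ETTf.
    pose proof (naturality (monad_mult T) f) as N.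
    pose proof (alg_mult a) as Q; simpl in N, Q |- *.
    rewrite <- comp_assoc, N, comp_assoc, Hξ, <- comp_assoc, Q.
    rewrite <- comp_assoc, <- fmap_comp, Hξ, fmap_comp, !comp_assoc.
    now rewrite Hξ. }
  set (q := @Build_Algebra X T y ξ Hu Hm : EilenbergMoore T).
  set (e := @Build_AlgebraHom X T a q f (eq_sym Hξ)
            : @Hom (EilenbergMoore T) a q).
  exists q, e; split; [split | exact Hf].
  - apply AlgebraHom_eq, Hf.
  - intros z g Hg; simpl in *.
    destruct (proj2 Hf (alg_obj z) (alg_map g)) as [u [Hu1 Hu2]].
    { exact (f_equal (@alg_map _ _ _ _) Hg). }
    assert (Hs : u ∘ ξ = alg_str z ∘ fmap T u).
    { apply ETf.
      rewrite <- comp_assoc, Hξ, comp_assoc, Hu1, alg_map_str.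
      rewrite <- comp_assoc, <- fmap_comp; now rewrite Hu1. }
    exists (@Build_AlgebraHom X T q z u Hs); split.
    + apply AlgebraHom_eq, Hu1.
    + intros u' Hu'; apply AlgebraHom_eq, Hu2.
      exact (f_equal (@alg_map _ _ _ _) Hu').
Qed.

End AlgebraExactness.

Section MonadicFunctors.

Variables (X A : Category) (F : Functor X A) (U : Functor A X).
Variable adj : Adjunction F U.
Hypothesis mon : monadic_adjunction adj.

Let ff := equivalence_fully_faithful mon.
Let eso := equivalence_essentially_surjective mon.

Lemma monadic_exactness_reflecting :
  has_finite_limits X ->
  preserves_regular_epis (induced_monad adj) ->
  preserves_kernel_pairs (induced_monad adj) ->
  exactness_reflecting U.
Proof.
  intros lim Tre Tkp; split.
  - exact (equivalence_finite_limits ff eso (algebras_finite_limits lim)).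
  - exact (right_adjoint_preserves_pullbacks adj).
  - exact (right_adjoint_preserves_relations adj).
  - exact (comparison_reflects_isos ff).
  - intros r a r1 r2 y f Hk Hf.
    destruct (forget_algebra_lifts_quotients Tre Tkp
                (r1 := fmap (comparison adj) r1) (r2 := fmap (comparison adj) r2)
                Hk Hf) as (q & e & He & HUe).
    destruct (equivalence_lifts_coequalizers ff eso He) as (q' & e' & i & He' & Hi & E).
    exists q', e'; split; [exact He' |].
    pose proof (coequalizer_iso HUe (functor_iso (forget_algebra _) Hi)) as H.
    rewrite <- fmap_comp, <- E in H; exact H.
Qed.

Local Notation η := (unit_at adj).
Local Notation ε := (counit_at adj).

(** Linton's construction: the coproduct of the objects [x i] is the quotient of
    the free object on the coproduct of the [U (x i)] that turns its injections
    into algebra morphisms.  This quotient is a coequalizer of a reflexive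
    pair. *)
Lemma monadic_coproducts :
  has_reflexive_coequalizers A -> has_finite_coproducts X ->
  has_finite_coproducts A.
Proof.
  intros rc cop I HI x.
  destruct (cop I HI (fun i => U (x i))) as (s & inj & Hs).
  destruct (cop I HI (fun i => U (F (U (x i))))) as (s' & inj' & Hs').
  destruct (Hs' s (fun i => inj i ∘ fmap U (ε (x i)))) as [α [Hα _]].
  destruct (Hs' (U (F s)) (fun i => fmap U (fmap F (inj i)))) as [β [Hβ _]].
  destruct (Hs s' (fun i => inj' i ∘ η (U (x i)))) as [σ [Hσ _]].
  (* a morphism out of [F s] coequalizes the pair exactly when its components
     are algebra morphisms *)
  assert (char : forall (y : A) (g : Hom (F s) y),
    g ∘ fmap F α = g ∘ untranspose adj β <->
    forall i, transpose adj g ∘ inj i ∘ fmap U (ε (x i))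
              = fmap U (ε y) ∘ fmap U (fmap F (transpose adj g ∘ inj i))).
  { intros y g.
    assert (El : forall i, transpose adj (g ∘ fmap F α) ∘ inj' i
                           = transpose adj g ∘ inj i ∘ fmap U (ε (x i))).
    { intros i; unfold transpose; rewrite fmap_comp.
      crw <- (unit_natural adj α); now rewrite Hα. }
    assert (Er : forall i, transpose adj (g ∘ untranspose adj β) ∘ inj' i
                 = fmap U (ε y) ∘ fmap U (fmap F (transpose adj g ∘ inj i))).
    { intros i; rewrite transpose_comp, untransposeK, <- comp_assoc, Hβ.
      rewrite !fmap_comp, comp_assoc, <- (fmap_comp U (ε y)); do 2 f_equal.
      symmetry; exact (transposeK adj g). }
    split.
    - intros e i; now rewrite <- El, <- Er, e.
    - intros e; apply (transpose_inj (adj := adj)), (coproduct_ext Hs'); intros i.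
      now rewrite El, Er. }
  destruct (rc _ _ (fmap F α) (untranspose adj β)) as (c & e & He).
  { exists (fmap F σ); split.
    - rewrite <- fmap_comp, <- fmap_id; f_equal.
      apply (coproduct_ext Hs); intros i; crw (Hσ i); crw (Hα i).
      crw (triangle_U adj (x i)); reflexivity.
    - apply (transpose_inj (adj := adj)).
      unfold untranspose; assoc; rewrite <- fmap_comp; fold (untranspose adj (β ∘ σ)).
      rewrite untransposeK; apply (coproduct_ext Hs); intros i.
      crw (Hσ i); crw (Hβ i); unfold transpose; rewrite fmap_id, comp_id_l.
      symmetry; apply unit_natural. }
  assert (Hj : forall i, exists j : Hom (x i) c,
                  fmap U j = transpose adj e ∘ inj i).
  { intros i; apply (comparison_full ff), (proj1 (char _ _) (proj1 He)). }
  set (j := fun i => proj1_sig (constructive_indefinite_description _ (Hj i))).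
  assert (Hj' : forall i, fmap U (j i) = transpose adj e ∘ inj i) by
    (intros i; exact (proj2_sig (constructive_indefinite_description _ (Hj i)))).
  exists c, j; intros y f.
  destruct (Hs (U y) (fun i => fmap U (f i))) as [h [Hh _]].
  destruct (proj2 He y (untranspose adj h)) as [u [Hu Hu']].
  { apply char; intros i; rewrite untransposeK, Hh, <- !fmap_comp; f_equal.
    symmetry; apply counit_natural. }
  exists u; split.
  - intros i; apply (comparison_faithful ff).
    rewrite fmap_comp, Hj', comp_assoc, <- transpose_comp, Hu, untransposeK.
    apply Hh.
  - intros v Hv; apply Hu', (transpose_inj (adj := adj)), (coproduct_ext Hs).
    intros i; rewrite untransposeK, Hh, transpose_comp, <- comp_assoc, <- Hj'.
    now rewrite <- fmap_comp, Hv.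
Qed.

End MonadicFunctors.

(** * Slice categories *)

Section Slice.

Variables (C : Category) (b : C).

Record SliceObj : Type := {
  slice_obj : C;
  slice_map : Hom slice_obj b
}.

Record SliceHom (x y : SliceObj) : Type := {
  slice_fun : Hom (slice_obj x) (slice_obj y);
  slice_fun_map : slice_map y ∘ slice_fun = slice_map x
}.

Lemma SliceHom_eq (x y : SliceObj) (f g : SliceHom x y) :
  slice_fun f = slice_fun g -> f = g.
Proof.
  destruct f as [f f1], g as [g g1]; simpl; intros <-.
  f_equal; apply proof_irrelevance.
Qed.

Definition Slice_comp (x y z : SliceObj) (g : SliceHom y z) (f : SliceHom x y) :
  SliceHom x z.
Proof.
  refine {| slice_fun := slice_fun g ∘ slice_fun f |}.
  now rewrite comp_assoc, !slice_fun_map.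
Defined.

Definition Slice : Category.
Proof.
  refine {| Obj := SliceObj; Hom := SliceHom;
            idm := fun x => {| slice_fun := idm (slice_obj x);
                               slice_fun_map := comp_id_r (slice_map x) |};
            comp := Slice_comp |}.
  - intros x y f; apply SliceHom_eq, comp_id_l.
  - intros x y f; apply SliceHom_eq, comp_id_r.
  - intros x y z w h g f; apply SliceHom_eq, comp_assoc.
Defined.

Definition slice_forget : Functor Slice C :=
  {| fobj := fun x : Slice => slice_obj x : C;
     fmap := fun x y (f : @Hom Slice x y) => slice_fun f;
     fmap_id := fun x => eq_refl;
     fmap_comp := fun x y z g f => eq_refl |}.

(** Limits in the slice over [b] are limits in [C] of diagrams to which [b] has
    been added as a sink; the sink cannot be left out, because of disconnected
    diagrams. *)
Section AddedSink.

Variable J : Category.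

Definition sink_arrow (i j : option J) : Type :=
  match i, j with
  | Some i, Some j => Hom i j
  | _, None => unit
  | None, Some _ => Empty_set
  end.

Definition sink_comp (i j k : option J) :
  sink_arrow j k -> sink_arrow i j -> sink_arrow i k :=
  match i, j, k return sink_arrow j k -> sink_arrow i j -> sink_arrow i k with
  | Some i, Some j, Some k => fun g f => g ∘ f
  | _, _, None => fun _ _ => tt
  | _, None, Some _ => fun g => match g with end
  | None, Some _, Some _ => fun _ f => match f with end
  end.

Definition add_sink : Category.
Proof.
  refine {| Obj := option J; Hom := sink_arrow;
            idm := fun i => match i with Some i => idm i | None => tt end;
            comp := sink_comp |}.
  - intros [i |] [j |]; simpl; try (intros []; reflexivity); apply comp_id_l.
  - intros [i |] [j |]; simpl; try (intros []; reflexivity); apply comp_id_r.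
  - intros [i |] [j |] [k |] [l |]; simpl; intros;
      try contradiction; try reflexivity; apply comp_assoc.
Defined.

Lemma add_sink_finite : finite_category J -> finite_category add_sink.
Proof.
  intros [[l Hl] HJ]; split.
  - exists (None :: map Some l); intros [i |]; simpl; [right | now left].
    apply in_map, Hl.
  - intros [i |] [j |]; simpl;
      solve [apply HJ | exists (tt :: nil); intros []; now left
            | exists nil; intros []].
Qed.

Variable D : Functor J Slice.

Definition sink_obj (i : option J) : C :=
  match i with Some i => slice_obj (D i) | None => b end.

Definition sink_map (i j : option J) : sink_arrow i j -> Hom (sink_obj i) (sink_obj j) :=
  match i, j return sink_arrow i j -> Hom (sink_obj i) (sink_obj j) with
  | Some i, Some j => fun u => slice_fun (fmap D u)
  | Some i, None => fun _ => slice_map (D i)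
  | None, None => fun _ => idm b
  | None, Some _ => fun u => match u with end
  end.

Definition sink_functor : Functor add_sink C.
Proof.
  refine (@Build_Functor add_sink C sink_obj sink_map _ _).
  - intros [i |]; simpl; [now rewrite fmap_id | reflexivity].
  - intros [i |] [j |] [k |]; simpl; intros; try contradiction;
      rewrite ?comp_id_l, ?fmap_comp; try reflexivity.
    symmetry; apply slice_fun_map.
Defined.

Definition sink_cone (M : Cone D) : Cone sink_functor.
Proof.
  refine (@Build_Cone add_sink C sink_functor (slice_obj (apex M))
            (fun j => match j return Hom (slice_obj (apex M)) (sink_obj j) with
                      | Some j => slice_fun (leg M j)
                      | None => slice_map (apex M)
                      end) _).
  intros [i |] [j |]; simpl; try (intros []; fail); intros u.
  - exact (f_equal (@slice_fun _ _) (leg_natural M u)).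
  - apply slice_fun_map.
  - apply comp_id_l.
Defined.

Lemma slice_limit : (exists K : Cone sink_functor, is_limit K) ->
  exists K : Cone D, is_limit K.
Proof.
  intros [K HK].
  set (l := Build_SliceObj (leg K (None : add_sink)) : Slice).
  set (p := fun j : J => leg K (Some j : add_sink)
              : Hom (apex K) (slice_obj (D j))).
  assert (Hp : forall j, slice_map (D j) ∘ p j = slice_map l)
    by (intros j; exact (leg_natural K (i := Some j : add_sink)
                           (j := None : add_sink) tt)).
  assert (Hn : forall i j (u : Hom i j),
    fmap D u ∘ (@Build_SliceHom l (D i) (p i) (Hp i) : @Hom Slice l (D i))
    = @Build_SliceHom l (D j) (p j) (Hp j)).
  { intros i j u; apply SliceHom_eq.
    exact (leg_natural K (i := Some i : add_sink) (j := Some j : add_sink) u). }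
  exists (@Build_Cone J Slice D l _ Hn); intros M.
  destruct (HK (sink_cone M)) as [m [Hm Hm']].
  assert (Hl : slice_map l ∘ (m : Hom (slice_obj (apex M)) (slice_obj l))
               = slice_map (apex M)) by exact (Hm None).
  exists (@Build_SliceHom (apex M) l m Hl); split.
  - intros j; apply SliceHom_eq; exact (Hm (Some j)).
  - intros m' H'; apply SliceHom_eq; apply Hm'; intros [j |].
    + exact (f_equal (@slice_fun _ _) (H' j)).
    + exact (slice_fun_map m').
Qed.

End AddedSink.

Lemma slice_exactness_reflecting :
  has_finite_limits C -> exactness_reflecting slice_forget.
Proof.
  intros lim; split.
  - intros J HJ D; apply slice_limit, lim, add_sink_finite, HJ.
  - intros a c d p f g p1 p2 H; simpl in *; apply pullback_intro.
    + exact (f_equal (@slice_fun _ _) (proj1 H)).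
    + (* a commutative square over the cospan lives in the slice *)
      intros x h k e.
      set (x' := Build_SliceObj (slice_map a ∘ h) : Slice).
      assert (Hk : slice_map c ∘ k = slice_map x').
      { simpl; rewrite <- (slice_fun_map f), <- (slice_fun_map g); assoc.
        now rewrite e. }
      set (h' := @Build_SliceHom x' a h eq_refl : @Hom Slice x' a).
      set (k' := @Build_SliceHom x' c k Hk : @Hom Slice x' c).
      destruct (pullback_lift H (h := h') (k := k')) as [u [U1 U2]].
      { apply SliceHom_eq, e. }
      exists (slice_fun u); split.
      * exact (f_equal (@slice_fun _ _) U1).
      * exact (f_equal (@slice_fun _ _) U2).
    + intros x u v e1 e2.
      set (x' := Build_SliceObj (slice_map p ∘ u) : Slice).
      assert (Hv : slice_map p ∘ v = slice_map x').
      { simpl; rewrite <- (slice_fun_map p1); assoc; now rewrite e1. }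
      set (u' := @Build_SliceHom x' p u eq_refl : @Hom Slice x' p).
      set (v' := @Build_SliceHom x' p v Hv : @Hom Slice x' p).
      refine (f_equal (@slice_fun _ _) (_ : u' = v')).
      apply (pullback_ext H); apply SliceHom_eq; assumption.
  - intros r a r1 r2 H x u v e1 e2; simpl in *.
    set (x' := Build_SliceObj (slice_map r ∘ u) : Slice).
    assert (Hv : slice_map r ∘ v = slice_map x').
    { simpl; rewrite <- (slice_fun_map r1); assoc; now rewrite e1. }
    set (u' := @Build_SliceHom x' r u eq_refl : @Hom Slice x' r).
    set (v' := @Build_SliceHom x' r v Hv : @Hom Slice x' r).
    refine (f_equal (@slice_fun _ _) (_ : u' = v')).
    apply H; apply SliceHom_eq; assumption.
  - intros x y f (g & G1 & G2); simpl in *.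
    assert (Hg : slice_map x ∘ g = slice_map y)
      by (rewrite <- (slice_fun_map f); crw G2; reflexivity).
    exists (@Build_SliceHom y x g Hg); split; apply SliceHom_eq; assumption.
  - intros r a r1 r2 y f _ Hf; simpl in *.
    destruct (proj2 Hf b (slice_map a)) as [s [Hs _]].
    { now rewrite !slice_fun_map. }
    set (q := Build_SliceObj s : Slice).
    set (e := @Build_SliceHom a q f Hs : @Hom Slice a q).
    exists q, e; split; [split | exact Hf].
    + apply SliceHom_eq, Hf.
    + intros z g Hg; simpl in *.
      destruct (proj2 Hf (slice_obj z) (slice_fun g)) as [u [Hu Hu']].
      { exact (f_equal (@slice_fun _ _) Hg). }
      assert (Hq : slice_map z ∘ u = slice_map q).
      { apply (coequalizer_epi Hf); simpl; rewrite Hs; crw Hu.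
        apply slice_fun_map. }
      exists (@Build_SliceHom q z u Hq); split; [apply SliceHom_eq, Hu |].
      intros u' H'; apply SliceHom_eq, Hu'.
      exact (f_equal (@slice_fun _ _) H').
Qed.

Lemma slice_finite_coproducts :
  has_finite_coproducts C -> has_finite_coproducts Slice.
Proof.
  intros cop I HI x.
  destruct (cop I HI (fun i => slice_obj (x i))) as (s & inj & Hs).
  destruct (Hs b (fun i => slice_map (x i))) as [m [Hm _]].
  set (s' := Build_SliceObj m : Slice).
  exists s', (fun i => @Build_SliceHom (x i) s' (inj i) (Hm i)); intros y f.
  destruct (Hs (slice_obj y) (fun i => slice_fun (f i))) as [u [Hu Hu']].
  assert (Hy : slice_map y ∘ u = slice_map s').
  { apply (coproduct_ext Hs); intros i; simpl; rewrite Hm; crw (Hu i).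
    apply slice_fun_map. }
  exists (@Build_SliceHom s' y u Hy); split.
  - intros i; apply SliceHom_eq, Hu.
  - intros u' H'; apply SliceHom_eq, Hu'; intros i.
    exact (f_equal (@slice_fun _ _) (H' i)).
Qed.

(** The identity of [b] is always terminal in the slice, and it is initial there
    when [b] is initial. *)
Lemma slice_pointed : is_initial b -> pointed Slice.
Proof.
  intros Hb; exists (Build_SliceObj (idm b)); split; intros x.
  - destruct (Hb (slice_obj x)) as [f _].
    assert (Hf : slice_map x ∘ f = idm b) by apply (initial_ext Hb).
    exists (@Build_SliceHom (Build_SliceObj (idm b)) x f Hf); split; [exact I |].
    intros g _; apply SliceHom_eq, (initial_ext Hb).
  - exists (@Build_SliceHom x (Build_SliceObj (idm b)) (slice_map x)
              (comp_id_l (slice_map x))); split; [exact I |].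
    intros g _; apply SliceHom_eq; simpl.
    now rewrite <- (slice_fun_map g), comp_id_l.
Qed.

Lemma slice_semi_abelian :
  is_initial b -> barr_exact C -> protomodular C -> has_finite_coproducts C ->
  semi_abelian Slice.
Proof.
  intros Hb ex pm cop.
  pose proof (slice_exactness_reflecting (proj1 ex)) as er.
  split; [now apply slice_pointed |].
  split; [exact (barr_exact_transfer er ex) |].
  split; [| now apply slice_finite_coproducts].
  apply (protomodular_transfer (U := slice_forget)); trivial.
  - exact (finite_limits_pullbacks (er_limits er)).
  - exact (er_pullbacks er).
  - exact (er_isos er).
Qed.

End Slice.

(** * Descent along a regular epimorphism to the terminal object *)

Section Descent.

Variables (C : Category) (z t : C) (v : Hom z t).
Hypothesis P : has_pullbacks C.
Hypothesis Ht : is_terminal t.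

Definition to_terminal (a : C) : Hom a t :=
  proj1_sig (constructive_indefinite_description (fun _ => True)
    (match Ht a with ex_intro _ f _ => ex_intro _ f I end)).

(** The product of [z] and [a], taken as a pullback over the terminal object so
    that the projection to [a] is a pullback of [v]. *)
Definition prod_pb (a : C) : Pullback v (to_terminal a) :=
  chosen_pullback P v (to_terminal a).

Definition pairing (x a : C) (h : Hom x z) (k : Hom x a) :
  Hom x (pb_obj (prod_pb a)) :=
  pb_lift (prod_pb a) (terminal_ext Ht (v ∘ h) (to_terminal a ∘ k)).

Definition base_map (a a' : C) (f : Hom a a') :
  Hom (pb_obj (prod_pb a)) (pb_obj (prod_pb a')) :=
  pairing (pb_fst (prod_pb a)) (f ∘ pb_snd (prod_pb a)).

Lemma fst_pairing (x a : C) (h : Hom x z) (k : Hom x a) :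
  pb_fst (prod_pb a) ∘ pairing h k = h.
Proof. apply pb_fst_lift. Qed.

Lemma snd_pairing (x a : C) (h : Hom x z) (k : Hom x a) :
  pb_snd (prod_pb a) ∘ pairing h k = k.
Proof. apply pb_snd_lift. Qed.

Definition base_change : Functor C (Slice z).
Proof.
  refine (@Build_Functor C (Slice z)
            (fun a => Build_SliceObj (pb_fst (prod_pb a)))
            (fun a a' f => @Build_SliceHom C z
               (Build_SliceObj (pb_fst (prod_pb a)))
               (Build_SliceObj (pb_fst (prod_pb a')))
               (base_map f) (fst_pairing _ _)) _ _).
  - intros a; apply SliceHom_eq, pb_hom_ext; simpl; unfold base_map.
    + now rewrite fst_pairing, comp_id_r.
    + now rewrite snd_pairing, comp_id_l, comp_id_r.
  - intros a a' a'' g f; apply SliceHom_eq, pb_hom_ext; simpl; unfold base_map.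
    + now rewrite comp_assoc, !fst_pairing.
    + now rewrite comp_assoc, !snd_pairing, <- !comp_assoc, snd_pairing.
Defined.

(** Products with [z] turn [f] into a pullback of [f], which is how regular
    epimorphisms are preserved. *)
Lemma base_map_pullback (a a' : C) (f : Hom a a') :
  is_pullback f (pb_snd (prod_pb a')) (pb_snd (prod_pb a)) (base_map f).
Proof.
  apply pullback_intro; unfold base_map.
  - symmetry; apply snd_pairing.
  - intros x h k e; exists (pairing (pb_fst (prod_pb a') ∘ k) h); split.
    + apply snd_pairing.
    + apply pb_hom_ext.
      * now rewrite comp_assoc, !fst_pairing.
      * crw (snd_pairing _ _); crw (snd_pairing _ _); exact e.
  - intros x u w e1 e2; apply pb_hom_ext; [| exact e1].
    rewrite <- (fst_pairing (pb_fst (prod_pb a)) (f ∘ pb_snd (prod_pb a))).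
    assoc; now rewrite e2.
Qed.

Definition base_change_adjunction : Adjunction (slice_forget z) base_change.
Proof.
  unshelve refine (@Build_Adjunction (Slice z) C (slice_forget z) base_change
    (@Build_NatTrans (Slice z) (Slice z) (id_functor _)
       (comp_functor base_change (slice_forget z))
       (fun x => @Build_SliceHom C z x (base_change (slice_obj x))
          (pairing (slice_map x) (idm (slice_obj x))) (fst_pairing _ _)) _)
    (@Build_NatTrans C C (comp_functor (slice_forget z) base_change) (id_functor C)
       (fun a => pb_snd (prod_pb a)) _) _ _).
  - intros x y f; apply SliceHom_eq, pb_hom_ext; simpl; unfold base_map.
    + rewrite !comp_assoc, !fst_pairing; apply slice_fun_map.
    + rewrite !comp_assoc, !snd_pairing, <- comp_assoc, snd_pairing.
      now rewrite comp_id_l, comp_id_r.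
  - intros a a' f; apply snd_pairing.
  - intros x; apply snd_pairing.
  - intros a; apply SliceHom_eq, pb_hom_ext; simpl; unfold base_map.
    + now rewrite comp_assoc, !fst_pairing, comp_id_r.
    + rewrite comp_assoc, snd_pairing, <- comp_assoc, snd_pairing.
      now rewrite comp_id_r.
Defined.

Hypothesis ex : barr_exact C.

Lemma base_change_regular_epis : preserves_regular_epis base_change.
Proof.
  intros a a' f Hf.
  apply (regular_epi_transfer (slice_exactness_reflecting z (proj1 ex)) _
           (proj1 (proj2 ex))).
  exact (proj2 (proj1 (proj2 ex)) _ _ _ _ _ _ _ _ (base_map_pullback f) Hf).
Qed.

Hypothesis Hv : regular_epi v.

Lemma snd_regular_epi (a : C) : regular_epi (pb_snd (prod_pb a)).
Proof.
  exact (proj2 (proj1 (proj2 ex)) _ _ _ _ _ _ _ _ (pb_is_pullback (prod_pb a)) Hv).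
Qed.

(** As the projections [z × x -> x] are epimorphisms, [f] is a monomorphism when
    [z × f] is; as [z × a' -> a'] is a regular epimorphism and equal, up to the
    isomorphism [z × f], to a morphism through [f], the monomorphism [f] is
    invertible. *)
Lemma base_change_reflects_isos : reflects_isos base_change.
Proof.
  intros a a' f Hi.
  apply (functor_iso (slice_forget z)) in Hi; simpl in Hi.
  assert (nat : pb_snd (prod_pb a') ∘ base_map f = f ∘ pb_snd (prod_pb a))
    by apply snd_pairing.
  apply (mono_regular_epi_iso (e := pb_snd (prod_pb a))).
  - intros x u w e; apply (regular_epi_epi (snd_regular_epi x)).
    transitivity (pb_snd (prod_pb a) ∘ base_map u); [symmetry; apply snd_pairing |].
    transitivity (pb_snd (prod_pb a) ∘ base_map w); [| apply snd_pairing].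
    f_equal; apply (iso_mono Hi), pb_hom_ext; unfold base_map.
    + now rewrite !comp_assoc, !fst_pairing.
    + rewrite !comp_assoc, !snd_pairing, <- !comp_assoc, !snd_pairing.
      rewrite !comp_assoc; now rewrite e.
  - rewrite <- nat.
    destruct (snd_regular_epi a') as (k & g & h & [Hc Hu]).
    destruct Hi as (j & J1 & J2); exists k, (j ∘ g), (j ∘ h); split.
    + crw J2; crw J2; exact Hc.
    + intros y e He; destruct (Hu y (e ∘ j)) as [w [Hw Hw']];
        [assoc; exact He |].
      exists w; split.
      * rewrite comp_assoc, Hw; crw J1; reflexivity.
      * intros w' <-; apply Hw'; crw J2; reflexivity.
Qed.

Lemma base_change_monadic :
  isos_of_points_local C -> monadic_adjunction base_change_adjunction.
Proof.
  intros pm; apply crude_monadicity.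
  - exact base_change_reflects_isos.
  - now apply exact_protomodular_reflexive_coequalizers.
  - apply exact_functor_reflexive_coequalizers; trivial.
    + exact base_change_regular_epis.
    + apply preserves_pullbacks_kernel_pairs.
      exact (right_adjoint_preserves_pullbacks base_change_adjunction).
Qed.

End Descent.

(** * Monadicity over semi-abelian categories *)

Lemma coproducts_initial (C : Category) :
  has_finite_coproducts C -> exists z : C, is_initial z.
Proof.
  intros cop.
  destruct (cop Empty_set) with (x := fun i : Empty_set => match i with end : C)
    as (z & inj & Hz).
  { exists nil; intros []. }
  exists z; intros y; destruct (Hz y (fun i => match i with end)) as [u [_ Hu]].
  exists u; split; [exact I |]; intros w _; apply Hu; intros [].
Qed.

(** The monad on the slice over [z] sends [x -> z] to [z × x -> z]; both functors
    that compose to it preserve regular epimorphisms and pullbacks. *)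
Lemma base_change_semi_abelian (A : Category) (z t : A) (v : Hom z t) :
  is_initial z -> is_terminal t -> regular_epi v ->
  barr_exact A -> protomodular A -> has_finite_coproducts A ->
  exists (X : Category) (U : Functor A X) (F : Functor X A) (adj : Adjunction F U),
    semi_abelian X /\ monadic_adjunction adj /\
    preserves_regular_epis (induced_monad adj) /\
    preserves_kernel_pairs (induced_monad adj).
Proof.
  intros Hz Ht Hv ex pm cop.
  destruct (proj1 (protomodular_isos_of_points A) pm) as [P loc].
  pose proof (slice_exactness_reflecting z (proj1 ex)) as er.
  exists (Slice z), (base_change v P Ht), (slice_forget z),
    (base_change_adjunction v P Ht).
  split; [now apply slice_semi_abelian |].
  split; [now apply base_change_monadic |]; split.
  - intros a b f Hf; apply (base_change_regular_epis v P Ht ex).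
    exact (proj1 (regular_epi_transfer er f (proj1 (proj2 ex))) Hf).
  - intros a b k f p1 p2 Hk.
    apply (right_adjoint_preserves_pullbacks (base_change_adjunction v P Ht)).
    exact (er_pullbacks er Hk).
Qed.

(** The image [i] of [z -> t] is a subobject of [t]; its image under [U] is a
    subobject of the zero object, hence everything. *)
Lemma monadic_pointed_initial_terminal (A X : Category) (U : Functor A X) :
  barr_exact A -> pointed X -> monadic U ->
  forall (z t : A) (f : Hom z t), is_terminal t -> regular_epi f.
Proof.
  intros ex (o & Ho & Ho') (F & adj & mon) z t f Ht.
  destruct (image_factorization (proj1 ex) (proj1 (proj2 ex)) f)
    as (i & e & m & He & Hm & <-).
  apply regular_epi_iso; [exact He |].
  apply (comparison_reflects_isos (equivalence_fully_faithful mon)).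
  pose proof (right_adjoint_preserves_terminal adj Ht) as HUt.
  destruct (Ho' (U t)) as [g _], (Ho (U i)) as [h _].
  apply (mono_split_iso (s := h ∘ g) (right_adjoint_preserves_mono adj Hm)).
  apply (terminal_ext HUt).
Qed.

Lemma monadic_protomodular (A X : Category) (U : Functor A X) :
  has_pullbacks A -> monadic U -> protomodular X -> protomodular A.
Proof.
  intros P (F & adj & mon); apply (protomodular_transfer (U := U)); trivial.
  - exact (right_adjoint_preserves_pullbacks adj).
  - exact (comparison_reflects_isos (equivalence_fully_faithful mon)).
Qed.

(** Exactness and protomodularity come first: they provide the reflexive
    coequalizers from which the coproducts are built. *)
Lemma monadic_exact_coproducts (A X : Category) (F : Functor X A) (U : Functor A X)
    (adj : Adjunction F U) :
  semi_abelian X -> monadic_adjunction adj ->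
  preserves_regular_epis (induced_monad adj) ->
  preserves_kernel_pairs (induced_monad adj) ->
  barr_exact A /\ has_finite_coproducts A.
Proof.
  intros (_ & ex & pm & cop) mon Tre Tkp.
  pose proof (monadic_exactness_reflecting mon (proj1 ex) Tre Tkp) as er.
  pose proof (barr_exact_transfer er ex) as exA; split; [exact exA |].
  apply (monadic_coproducts mon); [| exact cop].
  apply exact_protomodular_reflexive_coequalizers; [exact exA |].
  apply protomodular_isos_of_points.
  apply (monadic_protomodular (U := U) (finite_limits_pullbacks (proj1 exA)));
    [now exists F, adj | exact pm].
Qed.

Theorem theorem3p1 (A : Category) :
  let cond_a :=
    barr_exact A /\ protomodular A /\ has_finite_coproducts A /\
    (forall (z t : A) (f : Hom z t),
       is_initial z -> is_terminal t -> regular_epi f) in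
  let cond_b :=
    barr_exact A /\ has_finite_coproducts A /\
    (exists (X : Category) (U : Functor A X), semi_abelian X /\ monadic U) in
  let cond_c :=
    exists (X : Category) (U : Functor A X) (F : Functor X A)
           (adj : Adjunction F U),
      semi_abelian X /\ monadic_adjunction adj /\
      preserves_regular_epis (induced_monad adj) /\
      preserves_kernel_pairs (induced_monad adj) in
  (cond_a <-> cond_b) /\ (cond_b <-> cond_c).
Proof.
  intros cond_a cond_b cond_c.
  assert (ac : cond_a -> cond_c).
  { intros (ex & pm & cop & H01).
    destruct (coproducts_initial cop) as [z Hz].
    destruct (finite_limits_terminal (proj1 ex)) as [t Ht].
    destruct (Hz t) as [v _].
    exact (base_change_semi_abelian Hz Ht (H01 z t v Hz Ht) ex pm cop). }
  assert (cb : cond_c -> cond_b).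
  { intros (X & U & F & adj & HX & mon & Tre & Tkp).
    destruct (monadic_exact_coproducts HX mon Tre Tkp) as [ex cop].
    split; [exact ex | split; [exact cop |]].
    exists X, U; split; [exact HX | now exists F, adj]. }
  assert (ba : cond_b -> cond_a).
  { intros (ex & cop & X & U & HX & mon).
    split; [exact ex | split; [| split; [exact cop |]]].
    - exact (monadic_protomodular (finite_limits_pullbacks (proj1 ex)) mon
               (proj1 (proj2 (proj2 HX)))).
    - intros z t f _ Ht.
      exact (monadic_pointed_initial_terminal ex (proj1 HX) mon f Ht). }
  split; split; auto.
Qed.
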